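(* Let $R$ be a commutative ring with unit. (1) Let $G$ and $H$ be countable discrete groups with finite cohomological dimension over $R$. If $G$ and $H$ are coarsely equivalent, then $G$ is a duality group (resp. Poincaré duality group) over $R$ if and only if $H$ is a duality group (resp. Poincaré duality group) over $R$. (2) Let $G$ and $H$ be countable discrete groups which are coarsely equivalent. If $G$ and $H$ are amenable and $\mathbb Q\subseteq R$, then $G$ is a duality group (resp. Poincaré duality group) over $R$ if and only if $H$ is a duality group (resp. Poincaré duality group) over $R$.
   Context: A map $\varphi:G\to H$ is a coarse map if it has finite point preimages and for every $S\subseteq G\times G$ with $\{st^{-1}:(s,t)\in S\}$ finite, $\{\varphi(s)\varphi(t)^{-1}:(s,t)\in S\}$ is finite. Maps $\varphi,\phi:G\to H$ are close ($\sim$) if $\{\varphi(x)\phi(x)^{-1}:x\in G\}$ is finite. $G$ and $H$ are coarsely equivalent if there are coarse maps $\varphi:G\to H$, $\psi:H\to G$ with $\psi\circ\varphi\sim\mathrm{id}_G$ and $\varphi\circ\psi\sim\mathrm{id}_H$. A group $G$ is a duality group over $R$ if there are a right $RG$-module $C$ and an integer $n\ge0$ with natural isomorphisms $H^k(G,A)\cong H_{n-k}(G,C\otimes_RA)$ for all $k\in\mathbb Z$ and all $RG$-modules $A$ (with diagonal $G$-action $g(c\otimes a)=cg^{-1}\otimes ga$ on $C\otimes_RA$). $G$ is a Poincaré duality group over $R$ if moreover $C\cong R$ as $R$-modules. The cohomological dimension of $G$ over $R$ is $\mathrm{cd}_R\,G=\sup\{n:H^n(G,A)\ncong\{0\}\text{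 for some }RG\text{-module }A\}$. *)

(* Defs.v *)
From HB Require Import structures.
From mathcomp Require Import all_boot all_order all_algebra.
From mathcomp Require Import all_classical all_reals.
From mathcomp Require Import ereal Rstruct.

Set Implicit Arguments.
Unset Strict Implicit.
Unset Printing Implicit Defensive.
Import Order.TTheory GRing.Theory Num.Theory.
Local Open Scope classical_set_scope.
Local Open Scope ring_scope.
Local Open Scope quotient_scope.

Record submodule (R : pzRingType) (V : lmodType R) := Submodule {
  insubm :> V -> Prop;
  insubm0 : insubm 0;
  insubmP : forall (a : R) (u v : V), insubm u -> insubm v -> insubm (a *: u + v)
}.

Section SubmoduleQuotient.
Variables (R : pzRingType) (V : lmodType R) (S : submodule V).

Definition sub_pred : {pred V} := fun v => `[< S v >].

Lemma sub_predP v : reflect (S v) (v \in sub_pred).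
Proof. exact: asboolP. Qed.

Lemma sub_pred_submod : GRing.submod_closed sub_pred.
Proof.
split; first exact/sub_predP/insubm0.
by move=> a u v /sub_predP Su /sub_predP Sv; apply/sub_predP/insubmP.
Qed.

HB.instance Definition _ :=
  GRing.isSubmodClosed.Build R V sub_pred sub_pred_submod.

Definition subm := {v : V | v \in sub_pred}.
HB.instance Definition _ := SubType.on subm.
HB.instance Definition _ := Choice.on subm.
HB.instance Definition _ := [SubChoice_isSubLmodule of subm by <:].

Definition insubm_sub (v : V) (Sv : S v) : subm :=
  exist _ v (introT (sub_predP v) Sv).

Lemma subm_prop (v : subm) : S (val v).
Proof. exact/sub_predP/valP. Qed.

Fact subm_val_linear : linear (fun v : subm => val v).
Proof. by []. Qed.

Definition quo := Quotient.quot (sub_pred : zmodClosed V).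
HB.instance Definition _ := GRing.Zmodule.on quo.
HB.instance Definition _ := EqQuotient.on quo.

Definition quo_pi (v : V) : quo := \pi_quo v.

Lemma quo_eqP (u v : V) : quo_pi u = quo_pi v <-> S (u - v).
Proof.
rewrite /quo_pi; split=> [/eqP|Suv].
  by rewrite -Quotient.idealrBE => /sub_predP.
by apply/eqP; rewrite -Quotient.idealrBE; apply/sub_predP.
Qed.

Lemma quo_reprK (x : quo) : quo_pi (repr x) = x.
Proof. exact: reprK. Qed.

Lemma quo_ind (P : quo -> Prop) : (forall v, P (quo_pi v)) -> forall x, P x.
Proof. by move=> Pv x; rewrite -[x]quo_reprK. Qed.

Lemma quo_piD u v : quo_pi (u + v) = quo_pi u + quo_pi v.
Proof. by rewrite /quo_pi [LHS]Quotient.pi_add. Qed.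

Lemma submZ a v : S v -> S (a *: v).
Proof. by move=> Sv; rewrite -[_ *: _]addr0; apply: insubmP => //; apply: insubm0. Qed.

Definition quo_scale (a : R) (x : quo) : quo := quo_pi (a *: repr x).

Lemma quo_piZ a v : quo_scale a (quo_pi v) = quo_pi (a *: v).
Proof.
apply/quo_eqP; rewrite -scalerBr; apply: submZ.
by apply/quo_eqP; rewrite quo_reprK.
Qed.

Fact quo_scaleA a b x : quo_scale a (quo_scale b x) = quo_scale (a * b) x.
Proof. by elim/quo_ind: x => v; rewrite !quo_piZ scalerA. Qed.
Fact quo_scale1 : left_id 1 quo_scale.
Proof. by elim/quo_ind=> v; rewrite quo_piZ scale1r. Qed.
Fact quo_scaleDr : right_distributive quo_scale +%R.
Proof.
move=> a; elim/quo_ind=> u; elim/quo_ind=> v.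
by rewrite -quo_piD !quo_piZ scalerDr quo_piD.
Qed.
Fact quo_scaleDl x : {morph quo_scale^~ x : a b / a + b}.
Proof. by elim/quo_ind: x => v a b; rewrite !quo_piZ scalerDl quo_piD. Qed.

HB.instance Definition _ := GRing.Zmodule_isLmodule.Build R quo
  quo_scaleA quo_scale1 quo_scaleDr quo_scaleDl.

Fact quo_pi_linear : linear quo_pi.
Proof. by move=> a u v; rewrite quo_piD -quo_piZ. Qed.
HB.instance Definition _ := GRing.isLinear.Build R V quo _ quo_pi quo_pi_linear.

End SubmoduleQuotient.

(* The map of quotients induced by [f]; meaningful when [f] sends [S] into [S']. *)
Definition quo_map (R : pzRingType) (V V' : lmodType R)
    (S : submodule V) (S' : submodule V') (f : V -> V') : quo S -> quo S' :=
  fun x => quo_pi S' (f (repr x)).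

Lemma quo_map_pi (R : pzRingType) (V V' : lmodType R)
    (S : submodule V) (S' : submodule V') (f : {linear V -> V'}) (v : V) :
  (forall u, S u -> S' (f u)) -> quo_map S' f (quo_pi S v) = quo_pi S' (f v).
Proof.
move=> fS; apply/quo_eqP; rewrite -raddfB; apply: fS.
by apply/quo_eqP; rewrite quo_reprK.
Qed.

Section Subquotient.
Variables (R : pzRingType) (V : lmodType R) (Z B : submodule V).

Fact pull0 : B (val (0 : subm Z)). Proof. exact: insubm0. Qed.
Fact pullP (a : R) (u v : subm Z) :
  B (val u) -> B (val v) -> B (val (a *: u + v)).
Proof. by move=> Bu Bv; rewrite subm_val_linear; apply: insubmP. Qed.
Definition pull : submodule (subm Z) :=
  @Submodule R (subm Z) (fun v => B (val v)) pull0 pullP.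

(* Z / (Z :&: B), so that B need not be assumed to lie in Z; boundaries are cycles,
   so for the bar complexes below this is Z / B. *)
Definition subquo := quo pull.
HB.instance Definition _ := GRing.Lmodule.on subquo.

End Subquotient.

Section SubquotientMap.
Variables (R : pzRingType) (V V' : lmodType R).
Variables (Z B : submodule V) (Z' B' : submodule V') (f : V -> V').
Hypothesis fZ : forall v, Z v -> Z' (f v).

Definition subquo_map : subquo Z B -> subquo Z' B' :=
  @quo_map R (subm Z) (subm Z') (pull Z B) (pull Z' B')
    (fun v : subm Z => insubm_sub (fZ (subm_prop v))).

End SubquotientMap.

Section DirectSum.
Variables (R : pzRingType) (T : choiceType) (M : lmodType R).

Definition finsupported (f : T -> M) := finite_set [set t | f t != 0].

Fact finsupported0 : finsupported 0.
Proof.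
apply: (@sub_finite_set _ _ set0); last exact: finite_set0.
by move=> t /=; rewrite eqxx.
Qed.
Fact finsupportedP (a : R) (f g : T -> M) :
  finsupported f -> finsupported g -> finsupported (a *: f + g).
Proof.
move=> ff fg; apply: (@sub_finite_set _ _ ([set t | f t != 0] `|` [set t | g t != 0])).
  move=> t /= fgt; apply/orP; apply: contraNT fgt.
  rewrite negb_or !negbK => /andP[/eqP ft /eqP gt].
  by rewrite [_ t](_ : _ = a *: f t + g t) // ft gt scaler0 addr0.
by rewrite finite_setU.
Qed.
Definition finsupp_submodule : submodule (T -> M) :=
  @Submodule R (T -> M) finsupported finsupported0 finsupportedP.

Definition dirsum := subm finsupp_submodule.
HB.instance Definition _ := GRing.Lmodule.on dirsum.

Definition dcoef (x : dirsum) (t : T) : M := val x t.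

Lemma dirsumP (x y : dirsum) : dcoef x =1 dcoef y -> x = y.
Proof. by move=> xy; apply: val_inj; apply/funext. Qed.

Fact single_finsupported t m :
  finsupported (fun s => if s == t then m else 0).
Proof.
apply: (@sub_finite_set _ _ [set t]); last exact: finite_set1.
by move=> s /=; case: (s =P t) => // _; rewrite eqxx.
Qed.
Definition single (t : T) (m : M) : dirsum :=
  @insubm_sub R (T -> M) finsupp_submodule _ (single_finsupported t m).

Lemma dcoef_linear t : linear (dcoef^~ t).
Proof. by []. Qed.

Lemma single_linear t : linear (single t).
Proof.
move=> a m m'; apply: dirsumP => s; rewrite dcoef_linear /dcoef /=.
by case: ifP => // _; rewrite scaler0 addr0.
Qed.

End DirectSum.

Section DirectSumExtension.
Variables (R : pzRingType) (T : choiceType) (M W : lmodType R).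
Variable h : T -> M -> W.

(* The linear map sending [single t m] to [h t m], when every [h t] is linear. *)
Definition dext (x : dirsum T M) : W :=
  \sum_(t \in [set t | dcoef x t != 0]) h t (dcoef x t).

Hypothesis h_linear : forall t, linear (h t).

Let h0 t : h t 0 = 0.
Proof. by have := h_linear t (-1) 0 0; rewrite !scaleN1r !addNr. Qed.

Lemma dext_linear : linear dext.
Proof.
move=> a x y.
pose D := [set t | dcoef x t != 0] `|` [set t | dcoef y t != 0].
have Dfin : finite_set D.
  by rewrite finite_setU; split; [exact: (subm_prop x)|exact: (subm_prop y)].
have E (z : dirsum T M) : [set t | dcoef z t != 0] `<=` D ->
    dext z = \sum_(t \in D) h t (dcoef z t).
  move=> zD; apply: fsbig_widen => // t [_ /= /negP].
  by rewrite negbK => /eqP ->; rewrite h0.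
rewrite !E; first last.
- move=> t /=; rewrite dcoef_linear => zt; apply/orP; apply: contraNT zt.
  by rewrite negb_or !negbK => /andP[/eqP -> /eqP ->]; rewrite scaler0 addr0.
- by move=> t; left.
- by move=> t; right.
rewrite !fsbig_finite // scaler_sumr -big_split /=.
by apply: eq_bigr => t _; rewrite dcoef_linear h_linear.
Qed.

Lemma dext_single t m : dext (single t m) = h t m.
Proof.
rewrite /dext (@fsbig_widen _ _ _ _ _ [set t]).
- by rewrite fsbig_set1 /dcoef /= eqxx.
- by move=> s /=; rewrite /dcoef /=; case: (s =P t) => // _; rewrite eqxx.
- by move=> s [_ /= /negP]; rewrite negbK => /eqP ->; rewrite h0.
Qed.

End DirectSumExtension.

Lemma dirsum_gen (R : pzRingType) (T : choiceType) (M : lmodType R)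
    (S : submodule (dirsum T M)) :
  (forall t m, S (single t m)) -> forall x, S x.
Proof.
move=> S1 x; rewrite (_ : x = dext (@single R T M) x).
  have fin : finite_set [set t | dcoef x t != 0] := subm_prop x.
  rewrite /dext fsbig_finite //=; elim/big_ind: _ => //.
  - exact: insubm0.
  - by move=> u v Su Sv; rewrite -[u]scale1r; apply: insubmP.
apply: dirsumP => t.
have fin : finite_set [set t | dcoef x t != 0] := subm_prop x.
rewrite /dext fsbig_finite //=.
have dcoefD (u v : dirsum T M) : dcoef (u + v) t = dcoef u t + dcoef v t by [].
have dcoef0 : dcoef (0 : dirsum T M) t = 0 by [].
rewrite (big_morph (fun y : dirsum T M => dcoef y t) dcoefD dcoef0).
rewrite -fsbig_finite //= (@fsbig_widen _ _ _ _ _ setT) //; last first.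
  move=> s [_ /= /negP]; rewrite negbK => /eqP -> /=.
  by rewrite /dcoef /=; case: ifP.
rewrite -(@fsbig_widen _ _ _ _ [set t]) //.
  by rewrite fsbig_set1 {2}/dcoef /= eqxx.
by move=> s [_ /= /eqP st]; rewrite /dcoef /= ifN // eq_sym.
Qed.

Section Span.
Variables (R : pzRingType) (V : lmodType R) (P : V -> Prop).

Definition in_span (v : V) : Prop :=
  forall S : submodule V, (forall u, P u -> S u) -> S v.
Fact in_span0 : in_span 0.
Proof. by move=> S _; apply: insubm0. Qed.
Fact in_spanP (a : R) (u v : V) : in_span u -> in_span v -> in_span (a *: u + v).
Proof. by move=> Pu Pv S PS; apply: insubmP; [apply: Pu|apply: Pv]. Qed.
Definition span : submodule V := @Submodule R V in_span in_span0 in_spanP.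

Section Preimage.
Variables (W : lmodType R) (f : {linear V -> W}) (S : submodule W).
Fact preim0 : S (f 0). Proof. by rewrite raddf0; apply: insubm0. Qed.
Fact preimP (a : R) (u v : V) : S (f u) -> S (f v) -> S (f (a *: u + v)).
Proof. by move=> Su Sv; rewrite linearP; apply: insubmP. Qed.
Definition preim_submodule : submodule V :=
  @Submodule R V (fun v => S (f v)) preim0 preimP.
End Preimage.

Lemma span_lift (W : lmodType R) (f : {linear V -> W}) (S : submodule W) :
  (forall u, P u -> S (f u)) -> forall v, span v -> S (f v).
Proof. by move=> PS v /(_ (preim_submodule f S)); apply. Qed.

End Span.

Section Tensor.
Variables (R : comPzRingType) (C A : lmodType R).

Definition free_gen (X : choiceType) (x : X) : dirsum X R^o := single x (1 : R^o).

Inductive bilinear_rel : dirsum (C * A)%type R^o -> Prop :=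
| Bilin_Dl c c' a : bilinear_rel
    (free_gen (c + c', a) - free_gen (c, a) - free_gen (c', a))
| Bilin_Dr c a a' : bilinear_rel
    (free_gen (c, a + a') - free_gen (c, a) - free_gen (c, a'))
| Bilin_Zl r c a : bilinear_rel
    (free_gen (r *: c, a) - r *: free_gen (c, a))
| Bilin_Zr r c a : bilinear_rel
    (free_gen (c, r *: a) - r *: free_gen (c, a)).

Definition tensor := quo (span bilinear_rel).
HB.instance Definition _ := GRing.Lmodule.on tensor.

Definition tens (c : C) (a : A) : tensor := quo_pi _ (free_gen (c, a)).

Lemma tens_eq (u v w : dirsum (C * A)%type R^o) :
  bilinear_rel (u - v - w) -> quo_pi (span bilinear_rel) u = quo_pi _ v + quo_pi _ w.
Proof.
move=> r; rewrite -quo_piD; apply/quo_eqP => S; apply.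
by rewrite opprD addrA.
Qed.

Lemma tensDl c c' a : tens (c + c') a = tens c a + tens c' a.
Proof. by apply: tens_eq; apply: Bilin_Dl. Qed.
Lemma tensDr c a a' : tens c (a + a') = tens c a + tens c a'.
Proof. by apply: tens_eq; apply: Bilin_Dr. Qed.
Lemma tensZl r c a : tens (r *: c) a = r *: tens c a.
Proof.
rewrite -[RHS]linearZ; apply/quo_eqP => S; apply.
exact: Bilin_Zl.
Qed.
Lemma tensZr r c a : tens c (r *: a) = r *: tens c a.
Proof.
rewrite -[RHS]linearZ; apply/quo_eqP => S; apply.
exact: Bilin_Zr.
Qed.

Lemma tensor_ext (W : lmodType R) (f g : {linear tensor -> W}) :
  (forall c a, f (tens c a) = g (tens c a)) -> f =1 g.
Proof.
move=> fg; elim/quo_ind => x; apply/eqP; rewrite -subr_eq0; apply/eqP.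
pose F : dirsum (C * A)%type R^o -> W := fun x => f (quo_pi _ x) - g (quo_pi _ x).
have F0 : F 0 = 0 by rewrite /F !raddf0 ?subr0 ?addr0.
have FP a u v : F u = 0 -> F v = 0 -> F (a *: u + v) = 0.
  move=> /eqP; rewrite subr_eq0 => /eqP Fu /eqP; rewrite subr_eq0 => /eqP Fv.
  rewrite /F !(linearP (quo_pi _)) (linearP f) (linearP g) Fu Fv.
  exact: subrr.
apply: (@dirsum_gen _ _ _ (@Submodule _ _ (fun x => F x = 0) F0 FP)) => -[c a] r /=.
rewrite (_ : single _ r = r *: free_gen (c, a)); last first.
  apply: dirsumP => s; rewrite /free_gen /dcoef /=.
  rewrite [RHS](_ : _ = r * (if s == (c, a) then 1 else 0)) //.
  by case: ifP; rewrite ?mulr1 ?mulr0.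
by rewrite -[r *: _]addr0; apply: FP => //; rewrite /F fg subrr.
Qed.

End Tensor.

Section TensorMap.
Variables (R : comPzRingType) (C C' A A' : lmodType R).
Variables (f : {linear C -> C'}) (h : {linear A -> A'}).

Definition free_map : dirsum (C * A)%type R^o -> dirsum (C' * A')%type R^o :=
  dext (fun p (r : R^o) => r *: free_gen R (f p.1, h p.2)).

Fact free_map_comp_linear (p : C * A) :
  linear (fun r : R^o => r *: free_gen R (f p.1, h p.2)).
Proof. by move=> a r s; rewrite scalerDl scalerA. Qed.
Fact free_map_linear : linear free_map.
Proof. by apply: dext_linear => p; apply: free_map_comp_linear. Qed.
HB.instance Definition _ := GRing.isLinear.Build R
  (dirsum (C * A)%type R^o) (dirsum (C' * A')%type R^o) _ free_map free_map_linear.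

Lemma free_map_gen p : free_map (free_gen R p) = free_gen R (f p.1, h p.2).
Proof.
rewrite /free_map dext_single ?scale1r // => q.
exact: free_map_comp_linear.
Qed.

Definition tensor_map : tensor C A -> tensor C' A' :=
  quo_map _ free_map.

Lemma free_map_rel u : span (@bilinear_rel R C A) u ->
  span (@bilinear_rel R C' A') (free_map u).
Proof.
apply: span_lift => {}u ru S; apply.
case: ru => [c c' a|c a a'|r c a|r c a].
- rewrite !linearB /= !free_map_gen /= linearD; exact: Bilin_Dl.
- rewrite !linearB /= !free_map_gen /= linearD; exact: Bilin_Dr.
- rewrite linearB linearZ_LR /= !free_map_gen /= linearZ; exact: Bilin_Zl.
- rewrite linearB linearZ_LR /= !free_map_gen /= linearZ; exact: Bilin_Zr.
Qed.

Lemma tensor_map_tens c a : tensor_map (tens c a) = tens (f c) (h a).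
Proof.
rewrite /tensor_map quo_map_pi; last exact: free_map_rel.
by rewrite /= free_map_gen.
Qed.

Fact tensor_map_linear : linear tensor_map.
Proof.
move=> r; elim/quo_ind => u; elim/quo_ind => v.
rewrite -linearP /tensor_map !quo_map_pi -?linearP //; exact: free_map_rel.
Qed.
HB.instance Definition _ := GRing.isLinear.Build R
  (tensor C A) (tensor C' A') _ tensor_map tensor_map_linear.

End TensorMap.

(* An RG-module is an R-module with an R-linear action of G: the action of the
   group ring is determined by those of R and of G. *)
Record gmodule (R : pzRingType) (G : groupType) := GModule {
  gmod_sort :> lmodType R;
  gact : G -> {linear gmod_sort -> gmod_sort};
  gact1 : forall a, gact 1%g a = a;
  gactM : forall g h a, gact (g * h)%g a = gact g (gact h a)
}.

(* Right RG-modules; R is commutative in all uses, so R may act on the left. *)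
Record rgmodule (R : pzRingType) (G : groupType) := RGModule {
  rgmod_sort :> lmodType R;
  ract : G -> {linear rgmod_sort -> rgmod_sort};
  ract1 : forall c, ract 1%g c = c;
  ractM : forall g h c, ract (g * h)%g c = ract h (ract g c)
}.

Record ghom (R : pzRingType) (G : groupType) (A B : gmodule R G) := GHom {
  ghom_fun :> {linear A -> B};
  ghom_act : forall g a, ghom_fun (gact A g a) = gact B g (ghom_fun a)
}.

Section DiagonalAction.
Variables (R : comPzRingType) (G : groupType) (C : rgmodule R G).

Section Objects.
Variable A : gmodule R G.

(* g (c (x) a) = c g^-1 (x) g a *)
Definition diag_act (g : G) : {linear tensor C A -> tensor C A} :=
  tensor_map (ract C g^-1%g) (gact A g).

Fact diag_act1 x : diag_act 1%g x = x.
Proof.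
apply: (@tensor_ext _ _ _ _ (diag_act 1%g) idfun) => c a.
by rewrite /= tensor_map_tens invg1 ract1 gact1.
Qed.
Fact diag_actM g h x : diag_act (g * h)%g x = diag_act g (diag_act h x).
Proof.
apply: (@tensor_ext _ _ _ _ (diag_act (g * h)%g) (diag_act g \o diag_act h)) => c a.
by rewrite /= !tensor_map_tens invgM ractM gactM.
Qed.

Definition diag : gmodule R G := GModule diag_act1 diag_actM.
End Objects.

Fact diag_map_act (A B : gmodule R G) (f : ghom A B) g x :
  tensor_map (@idfun C) f (gact (diag A) g x) =
  gact (diag B) g (tensor_map (@idfun C) f x).
Proof.
pose F := tensor_map (@idfun C) f.
apply: (@tensor_ext _ _ _ _ (F \o gact (diag A) g) (gact (diag B) g \o F)) => c a.
by rewrite /= !tensor_map_tens /= ghom_act.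
Qed.
Definition diag_map (A B : gmodule R G) (f : ghom A B) : ghom (diag A) (diag B) :=
  @GHom R G (diag A) (diag B) (tensor_map (@idfun C) f) (diag_map_act f).

End DiagonalAction.

(* H^*(G, A) = Ext_RG^*(R, A) and H_*(G, M) = Tor^RG_*(R, M) are computed by the
   inhomogeneous complexes coming from the bar resolution of R over RG. *)
Definition gtuple (G : groupType) (n : nat) := {ffun 'I_n -> G}.
HB.instance Definition _ G n := Choice.on (gtuple G n).

(* The i-th face of the bar construction, for 0 <= i <= n + 1:
   (g_0, ..., g_n) is sent to (g_1, ..., g_n) if i = 0, to
   (g_0, ..., g_(i-1) g_i, ..., g_n) if 0 < i <= n, and to (g_0, ..., g_(n-1))
   if i = n + 1. *)
Definition face (G : groupType) (n i : nat) (t : gtuple G n.+1) : gtuple G n :=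
  [ffun j : 'I_n =>
     if (j.+1 < i)%N then t (widen_ord (leqnSn n) j)
     else if j.+1 == i then (t (widen_ord (leqnSn n) j) * t (lift ord0 j))%g
     else t (lift ord0 j)].

Section Cohomology.
Variables (R : comPzRingType) (G : groupType).

Section Objects.
Variable A : gmodule R G.

Definition cochain (n : nat) := gtuple G n -> A.
HB.instance Definition _ n := GRing.Lmodule.on (cochain n).

Definition cobd (n : nat) (f : cochain n) : cochain n.+1 := fun t =>
  gact A (t ord0) (f (face 0 t))
  + \sum_(i < n.+1) (-1) ^+ i.+1 *: f (face i.+1 t).

Fact cobd_linear n : linear (@cobd n).
Proof.
move=> a f g; apply/funext => t.
rewrite [RHS](_ : _ = a *: cobd f t + cobd g t) // /cobd.
have E s : (a *: f + g : cochain n) s = a *: f s + g s by [].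
rewrite E linearP scalerDr addrACA; congr (_ + _).
rewrite scaler_sumr -big_split /=; apply: eq_bigr => i _.
by rewrite E scalerDr !scalerA mulrC.
Qed.
HB.instance Definition _ n :=
  GRing.isLinear.Build R (cochain n) (cochain n.+1) _ (@cobd n) (@cobd_linear n).

Definition is_cocycle n (f : cochain n) : Prop := cobd f = 0.
Fact cocycle0 n : is_cocycle (0 : cochain n). Proof. exact: raddf0. Qed.
Fact cocycleP n a (f g : cochain n) :
  is_cocycle f -> is_cocycle g -> is_cocycle (a *: f + g).
Proof.
by rewrite /is_cocycle cobd_linear => -> ->; rewrite scaler0 addr0.
Qed.
Definition cocycle n : submodule (cochain n) :=
  @Submodule _ _ _ (cocycle0 n) (@cocycleP n).

Definition is_coboundary n : cochain n -> Prop :=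
  match n with
  | 0 => fun f => f = 0
  | m.+1 => fun f => exists e : cochain m, f = cobd e
  end.
Fact coboundary0 n : is_coboundary (0 : cochain n).
Proof. by case: n => [|n] //; exists 0; rewrite raddf0. Qed.
Fact coboundaryP n a (f g : cochain n) :
  is_coboundary f -> is_coboundary g -> is_coboundary (a *: f + g).
Proof.
case: n f g => [|n] f g /=; first by move=> -> ->; rewrite scaler0 addr0.
by move=> [f' ->] [g' ->]; exists (a *: f' + g'); rewrite linearP.
Qed.
Definition coboundary n : submodule (cochain n) :=
  @Submodule _ _ _ (coboundary0 n) (@coboundaryP n).

(* Cohomology is zero in negative degrees, and so is homology below. *)
Definition Hcoh (k : int) : lmodType R :=
  match k with
  | Posz n => subquo (cocycle n) (coboundary n)
  | Negz _ => 'rV[R]_0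
  end.

End Objects.

Definition cochain_map (A B : gmodule R G) (f : ghom A B) n (c : cochain A n) :
  cochain B n := fun t => f (c t).

Fact cochain_map_linear A B (f : ghom A B) n : linear (@cochain_map A B f n).
Proof. by move=> a c d; apply/funext => t; rewrite /cochain_map linearP. Qed.
HB.instance Definition _ A B (f : ghom A B) n :=
  GRing.isLinear.Build R (cochain A n) (cochain B n) _ (@cochain_map A B f n)
    (@cochain_map_linear A B f n).

Lemma cochain_map_cobd A B (f : ghom A B) n (c : cochain A n) :
  cochain_map f (cobd c) = cobd (cochain_map f c).
Proof.
apply/funext => t; rewrite /cochain_map /cobd linearD ghom_act raddf_sum.
by congr (_ + _); apply: eq_bigr => i _; rewrite /= linearZ_LR.
Qed.

Lemma cochain_map_cocycle A B (f : ghom A B) n (c : cochain A n) :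
  cocycle A n c -> cocycle B n (cochain_map f c).
Proof.
by move=> c0; rewrite /= /is_cocycle -cochain_map_cobd c0 raddf0.
Qed.

Lemma cochain_map_coboundary A B (f : ghom A B) n (c : cochain A n) :
  coboundary A n c -> coboundary B n (cochain_map f c).
Proof.
case: n c => [|n] c /=; first by move=> ->; rewrite raddf0.
by move=> [e ->]; exists (cochain_map f e); rewrite cochain_map_cobd.
Qed.

Definition Hcoh_map (A B : gmodule R G) (f : ghom A B) (k : int) :
    Hcoh A k -> Hcoh B k :=
  match k with
  | Posz n => subquo_map (coboundary B n) (@cochain_map_cocycle A B f n)
  | Negz _ => id
  end.

End Cohomology.

Section Homology.
Variables (R : comPzRingType) (G : groupType).

Section Objects.
Variable M : gmodule R G.

(* The chain sum_t m_t [t_0 | ... | t_(n-1)] is the function t |-> m_t. *)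
Definition chain (n : nat) := dirsum (gtuple G n) M.
HB.instance Definition _ n := GRing.Lmodule.on (chain n).

(* M is turned into a right module by m g := g^-1 m. *)
Definition bd_single (n : nat) (t : gtuple G n.+1) (m : M) : chain n :=
  single (face 0 t) (gact M (t ord0)^-1%g m)
  + \sum_(i < n.+1) (-1) ^+ i.+1 *: single (face i.+1 t) m.

Definition bd (n : nat) : chain n.+1 -> chain n := dext (@bd_single n).

Fact bd_single_linear n t : linear (@bd_single n t).
Proof.
move=> a m m'; rewrite /bd_single linearP single_linear scalerDr addrACA.
congr (_ + _); rewrite scaler_sumr -big_split /=; apply: eq_bigr => i _.
by rewrite single_linear scalerDr !scalerA mulrC.
Qed.
Fact bd_linear n : linear (@bd n).
Proof. by apply: dext_linear => t; apply: bd_single_linear. Qed.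
HB.instance Definition _ n :=
  GRing.isLinear.Build R (chain n.+1) (chain n) _ (@bd n) (@bd_linear n).

Definition is_cycle n : chain n -> Prop :=
  match n with
  | 0 => fun _ => True
  | m.+1 => fun x => bd x = 0
  end.
Fact cycle0 n : is_cycle (0 : chain n).
Proof. by case: n => // n /=; rewrite raddf0. Qed.
Fact cycleP n a (x y : chain n) : is_cycle x -> is_cycle y -> is_cycle (a *: x + y).
Proof.
case: n x y => // n x y /=.
by rewrite bd_linear => -> ->; rewrite scaler0 addr0.
Qed.
Definition cycle n : submodule (chain n) :=
  @Submodule _ _ _ (cycle0 n) (@cycleP n).

Definition is_boundary n (x : chain n) : Prop := exists y : chain n.+1, x = bd y.
Fact boundary0 n : is_boundary (0 : chain n).
Proof. by exists 0; rewrite raddf0. Qed.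
Fact boundaryP n a (x y : chain n) :
  is_boundary x -> is_boundary y -> is_boundary (a *: x + y).
Proof. by move=> [x' ->] [y' ->]; exists (a *: x' + y'); rewrite linearP. Qed.
Definition boundary n : submodule (chain n) :=
  @Submodule _ _ _ (boundary0 n) (@boundaryP n).

Definition Hhom (k : int) : lmodType R :=
  match k with
  | Posz n => subquo (cycle n) (boundary n)
  | Negz _ => 'rV[R]_0
  end.

End Objects.

Section Maps.
Variables (M N : gmodule R G) (f : ghom M N).

Definition chain_map n : chain M n -> chain N n :=
  dext (fun t m => single t (f m)).

Fact chain_map_comp_linear n t :
  linear (fun m => single t (f m) : chain N n).
Proof. by move=> a m m'; rewrite linearP single_linear. Qed.
Fact chain_map_linear n : linear (@chain_map n).
Proof. by apply: dext_linear => t; apply: chain_map_comp_linear. Qed.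
HB.instance Definition _ n :=
  GRing.isLinear.Build R (chain M n) (chain N n) _ (@chain_map n) (@chain_map_linear n).

Lemma chain_map_single n (t : gtuple G n) m :
  chain_map (single t m) = single t (f m).
Proof. by rewrite /chain_map dext_single //; apply: chain_map_comp_linear. Qed.

Lemma chain_map_bd n (x : chain M n.+1) : chain_map (bd x) = bd (chain_map x).
Proof.
pose F x := chain_map (bd x) - bd (chain_map x) : chain N n.
have F0 : F 0 = 0 by rewrite /F !raddf0 ?subr0 ?addr0.
have FP a u v : F u = 0 -> F v = 0 -> F (a *: u + v) = 0.
  move=> /eqP; rewrite subr_eq0 => /eqP Fu /eqP; rewrite subr_eq0 => /eqP Fv.
  by rewrite /F bd_linear !chain_map_linear bd_linear Fu Fv subrr.
apply/eqP; rewrite -subr_eq0; apply/eqP.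
apply: (@dirsum_gen _ _ _ (@Submodule _ _ (fun x => F x = 0) F0 FP)) => t m /=.
apply/eqP; rewrite subr_eq0; apply/eqP.
rewrite chain_map_single /bd !dext_single; [|exact: bd_single_linear..].
rewrite /bd_single linearD raddf_sum /= chain_map_single ghom_act.
by congr (_ + _); apply: eq_bigr => i _; rewrite linearZ_LR /= chain_map_single.
Qed.

Lemma chain_map_cycle n (x : chain M n) : cycle M n x -> cycle N n (chain_map x).
Proof. by case: n x => // n x /= x0; rewrite -chain_map_bd x0 raddf0. Qed.

Lemma chain_map_boundary n (x : chain M n) :
  boundary M n x -> boundary N n (chain_map x).
Proof. by move=> [y ->]; exists (chain_map y); rewrite chain_map_bd. Qed.

Definition Hhom_map (k : int) : Hhom M k -> Hhom N k :=
  match k with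
  | Posz n => subquo_map (boundary N n) (@chain_map_cycle n)
  | Negz _ => id
  end.

End Maps.
End Homology.

Definition natural_duality (R : comPzRingType) (G : groupType)
    (C : rgmodule R G) (n : nat) : Prop :=
  forall k : int,
  exists phi : forall A : gmodule R G, {linear Hcoh A k -> Hhom (diag C A) (n%:Z - k)},
    (forall A, bijective (phi A)) /\
    (forall (A B : gmodule R G) (f : ghom A B) (x : Hcoh A k),
       phi B (Hcoh_map f x) = Hhom_map (diag_map C f) (phi A x)).

Definition duality_group (R : comPzRingType) (G : groupType) : Prop :=
  exists (C : rgmodule R G) (n : nat), natural_duality C n.

Definition Poincare_duality_group (R : comPzRingType) (G : groupType) : Prop :=
  exists (C : rgmodule R G) (n : nat),
    natural_duality C n /\ exists e : {linear C -> R^o}, bijective e.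

Notation reals := Rdefinitions.R.

(* The dimension may be +oo; it is -oo exactly when R is the zero ring. *)
Definition cd (R : comPzRingType) (G : groupType) : \bar reals :=
  ereal_sup [set (n%:R : reals)%:E | n in
    [set n : nat | exists (A : gmodule R G) (x : Hcoh A n), x != 0]].

Section Coarse.
Variables G H : groupType.

Definition coarse_map (phi : G -> H) : Prop :=
  (forall y : H, finite_set (phi @^-1` [set y])) /\
  (forall S : set (G * G),
     finite_set [set (p.1 * p.2^-1)%g | p in S] ->
     finite_set [set (phi p.1 * (phi p.2)^-1)%g | p in S]).

Definition close (phi psi : G -> H) : Prop :=
  finite_set [set (phi x * (psi x)^-1)%g | x in [set: G]].

End Coarse.

Definition coarsely_equivalent (G H : groupType) : Prop :=
  exists (phi : G -> H) (psi : H -> G),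
    [/\ coarse_map phi, coarse_map psi,
        close (psi \o phi) id & close (phi \o psi) id].

Definition bounded_real (T : Type) (f : T -> reals) : Prop :=
  exists M : reals, forall x, `|f x| <= M.

(* A left invariant mean on the bounded functions on [G]; the values of [m] on
   unbounded functions are irrelevant. *)
Definition invariant_mean (G : groupType) (m : (G -> reals) -> reals) : Prop :=
  [/\ forall (a : reals) (f g : G -> reals), bounded_real f -> bounded_real g ->
        m (fun x => a * f x + g x) = a * m f + m g,
      forall f : G -> reals, bounded_real f -> (forall x, 0 <= f x) -> 0 <= m f,
      m (fun=> 1) = 1 &
      forall (s : G) (f : G -> reals), bounded_real f -> m (fun x => f (s * x)%g) = m f].

Definition amenable (G : groupType) : Prop := exists m, @invariant_mean G m.

(* Main.v *)
(* Write RG M for the finitely supported functions G -> M. In homogeneous form,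
   H^k(G, RG M) only involves functions of k + 1 points of G and the coarse structure
   of G, and close maps are related by the prism homotopy. So a coarse equivalence gives
   isomorphisms H^k(G, RG M) = H^k(H, RH M) that are natural in the R-module M.

   If G is a duality group of dimension n with dualizing module C, then H^k(G, RG M) is
   0 for k <> n and naturally C (x) M for k = n, hence the same holds for H. Let D be
   H^n(H, RH) with the action of H by right multiplication, so that D is isomorphic to C
   over R. If moreover H^k(H, -) vanishes for k > n, then H^n(H, A) and H_0(H, D (x) A)
   are both quotients of H^n(H, RH A) = D (x) A, with the same kernel. The lower degrees
   follow by dimension shifting along 0 -> K -> RH A -> A -> 0, which splits over R, so
   that it stays exact after tensoring with D.

   The vanishing above n follows by descending induction, along the same sequence, when
   the cohomological dimension of H is finite. When H is amenable and R contains the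
   rationals, A is a direct summand of the module of the functions f : H -> A for which
   y f(y) takes finitely many values: compose the mean with a Q-linear retraction of the
   reals onto Q. The cohomology of H in this module embeds, by a coarse equivalence, in
   the cohomology of G in some module, which vanishes above n. *)

From HB Require Import structures.
Require Import Defs.
From mathcomp Require Import all_boot all_order all_algebra.
From mathcomp Require Import all_classical all_reals ereal Rstruct.
From mathcomp Require Import zify.

Set Implicit Arguments.
Unset Strict Implicit.
Unset Printing Implicit Defensive.
Import Order.TTheory GRing.Theory Num.Theory Defs.
Local Open Scope classical_set_scope.
Local Open Scope ring_scope.

(** The action of G on C cannot be carried along a coarse map, and [natural_duality] gives no
    compatibility with connecting maps. What does transfer is a family C (x) M -> H^n(H, RH M)
    natural in the R-module M. Naturality along the maps R -> M, r |-> r m, forces such a family to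
    be the canonical map [dual_mu] preceded by an R-isomorphism C -> H^n(H, RH). Hence [dual_mu] is
    bijective, a property in which C no longer occurs, and the isomorphisms in all degrees are built
    anew for H. The finitely supported functions and the functions f with y f(y) finitely valued are
    both [local] modules, so the comparison of cohomology is proved once, for all local modules. The
    mean has real values, while R only contains Q. An additive retraction of the reals onto Q need
    not respect positivity, but it leaves a finitely additive invariant measure with values in R,
    and this is enough to integrate functions with finitely many values. *)

Definition mk_linear (R : pzRingType) (U V : lmodType R) (f : U -> V)
    (fP : linear f) : {linear U -> V} :=
  HB.pack f (GRing.isLinear.Build R U V _ f fP).

Lemma inj_surj_bij (U V : Type) (f : U -> V) :
  injective f -> (forall y, exists x, f x = y) -> bijective f.
Proof.
move=> fI fS; pose g y := sval (cid (fS y)).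
have fg : cancel g f by move=> y; apply: (svalP (cid (fS y))).
by exists g => // x; apply: fI; rewrite fg.
Qed.

(** * Linear algebra: quotients, direct sums, tensor products, subquotients *)

Section LinearAlgebra.
Variables (R : pzRingType) (U V W : lmodType R).

Lemma submB (S : submodule U) u v : S u -> S v -> S (u - v).
Proof. by move=> Su Sv; rewrite addrC -scaleN1r; apply: insubmP. Qed.

Lemma linear_inj_of_ker (f : {linear U -> V}) :
  (forall x, f x = 0 -> x = 0) -> injective f.
Proof.
move=> f0 x y fxy; apply/eqP; rewrite -subr_eq0; apply/eqP/f0.
by rewrite linearB fxy subrr.
Qed.

Lemma linear_inv (f : {linear U -> V}) : bijective f ->
  exists g : {linear V -> U}, cancel f g /\ cancel g f.
Proof.
case=> g fK gK.
have gL : linear g.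
  by move=> a x y; apply: (can_inj fK); rewrite linearP !gK.
by exists (mk_linear gL).
Qed.

(** Two quotients of one module with the same kernel; used for H^n(G, A) and H_0(G, D (x) A). The
    injective counterpart [factor_inj] serves the dimension shift. *)
Lemma factor_surj (p : {linear U -> V}) (q : {linear U -> W}) :
  (forall y, exists x, p x = y) -> (forall z, exists x, q x = z) ->
  (forall x, p x = 0 <-> q x = 0) ->
  exists f : {linear V -> W}, bijective f /\ (forall x, f (p x) = q x).
Proof.
move=> pS qS pq0.
have pq x y : p x = p y <-> q x = q y.
  by split=> /eqP; rewrite -subr_eq0 -linearB => /eqP/pq0/eqP;
    rewrite linearB subr_eq0 => /eqP.
pose s y := sval (cid (pS y)).
have ps y : p (s y) = y by apply: (svalP (cid (pS y))).
pose f y := q (s y).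
have fp x : f (p x) = q x by apply/pq; rewrite ps.
have fL : linear f.
  by move=> a x y; rewrite -[x]ps -[y]ps -linearP !fp linearP.
exists (mk_linear fL); split=> //.
apply: inj_surj_bij => [y y'|z].
  by rewrite -[y]ps -[y']ps /= !fp => /pq.
by have [x <-] := qS z; exists (p x); apply: fp.
Qed.

Lemma factor_inj (i : {linear U -> W}) (j : {linear V -> W}) :
  injective i -> injective j ->
  (forall w, (exists u, i u = w) <-> (exists v, j v = w)) ->
  exists f : {linear U -> V}, bijective f /\ (forall u, j (f u) = i u).
Proof.
move=> iI jI ij.
have S u : exists v, j v = i u by apply/ij; exists u.
pose f u := sval (cid (S u)).
have jf u : j (f u) = i u by apply: (svalP (cid (S u))).
have fL : linear f by move=> a x y; apply: jI; rewrite linearP !jf linearP.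
exists (mk_linear fL); split=> //.
apply: inj_surj_bij => [u u' fu|v].
  by apply: iI; rewrite -!jf; congr (j _).
have [u iu] : exists u, i u = j v by apply/ij; exists v.
by exists u; apply: jI; rewrite -iu; apply: jf.
Qed.

End LinearAlgebra.

Section DirsumMaps.
Variables (R : pzRingType) (T : choiceType) (M W : lmodType R).

Lemma dirsum_linear_ext (f g : {linear dirsum T M -> W}) :
  (forall t m, f (single t m) = g (single t m)) -> f =1 g.
Proof.
move=> fg x; apply/eqP; rewrite -subr_eq0; apply/eqP.
pose D x := f x - g x.
have D0 : D 0 = 0 by rewrite /D !raddf0 ?subr0 ?addr0.
have DP a u v : D u = 0 -> D v = 0 -> D (a *: u + v) = 0.
  move=> /eqP; rewrite subr_eq0 => /eqP fu /eqP; rewrite subr_eq0 => /eqP fv.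
  by rewrite /D (linearP f) (linearP g) fu fv subrr.
apply: (@dirsum_gen _ _ _ (@Submodule _ _ (fun x => D x = 0) D0 DP)) => t m /=.
by rewrite /D fg subrr.
Qed.

Definition dlin (h : T -> {linear M -> W}) : {linear dirsum T M -> W} :=
  mk_linear (dext_linear (fun t => linearP (h t))).

Lemma dlin_single h t m : dlin h (single t m) = h t m.
Proof. by rewrite /dlin /= dext_single // => s; apply: linearP. Qed.

Definition slin (t : T) : {linear M -> dirsum T M} := mk_linear (@single_linear R T M t).

End DirsumMaps.

Section TensorLift.
Variables (R : comPzRingType) (C A W : lmodType R) (b : C -> A -> W).
Hypothesis bl : forall a, linear (b^~ a).
Hypothesis br : forall c, linear (b c).

Let free_lift_linear : linear
  (dext (fun (p : C * A) (r : R^o) => r *: b p.1 p.2) : dirsum (C * A)%type R^o -> W).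
Proof. by apply: dext_linear => p a r s; rewrite scalerDl scalerA. Qed.
Let free_lift := mk_linear free_lift_linear.

Let free_lift_gen p : free_lift (free_gen R p) = b p.1 p.2.
Proof.
rewrite /free_lift /= dext_single ?scale1r // => q a r s.
by rewrite scalerDl scalerA.
Qed.

Fact null0 : (0 : W) = 0. Proof. by []. Qed.
Fact nullP (a : R) (u v : W) : u = 0 -> v = 0 -> a *: u + v = 0.
Proof. by move=> -> ->; rewrite scaler0 addr0. Qed.
Definition null_submodule : submodule W := @Submodule R W (fun w => w = 0) null0 nullP.

Let lin_add (V : lmodType R) (f : V -> W) (u v : V) : linear f -> f (u + v) = f u + f v.
Proof. by move=> fL; rewrite -[u]scale1r fL !scale1r. Qed.
Let lin_scale (V : lmodType R) (f : V -> W) a (u : V) : linear f -> f (a *: u) = a *: f u.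
Proof.
move=> fL; have f0 : f 0 = 0.
  by have := fL (-1) 0 0; rewrite !scaleN1r !addNr.
by rewrite -[a *: u]addr0 fL f0 addr0.
Qed.

Let free_lift_rel u : span (@bilinear_rel R C A) u -> free_lift u = 0.
Proof.
move=> ru; apply: (ru (preim_submodule free_lift null_submodule)) => {ru}u ru.
suff: free_lift u = 0 by [].
case: ru => [c c' a|c a a'|r c a|r c a].
- by rewrite !(linearB free_lift) !free_lift_gen (lin_add _ _ (bl a)) addrAC addrK subrr.
- by rewrite !(linearB free_lift) !free_lift_gen (lin_add _ _ (br c)) addrAC addrK subrr.
- by rewrite (linearB free_lift) (linearZ_LR free_lift) !free_lift_gen (lin_scale _ _ (bl a)) subrr.
- by rewrite (linearB free_lift) (linearZ_LR free_lift) !free_lift_gen (lin_scale _ _ (br c)) subrr.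
Qed.

Definition tensor_lift_fun (x : tensor C A) : W := free_lift (repr x).

Let tensor_lift_pi u : tensor_lift_fun (quo_pi _ u) = free_lift u.
Proof.
rewrite /tensor_lift_fun; apply/eqP; rewrite -subr_eq0 -linearB; apply/eqP.
by apply: free_lift_rel; apply/quo_eqP; rewrite quo_reprK.
Qed.

Fact tensor_lift_linear : linear tensor_lift_fun.
Proof.
move=> a; elim/quo_ind=> u; elim/quo_ind=> v.
by rewrite -linearP !tensor_lift_pi linearP.
Qed.
Definition tensor_lift : {linear tensor C A -> W} := mk_linear tensor_lift_linear.

Lemma tensor_lift_tens c a : tensor_lift (tens c a) = b c a.
Proof. by rewrite /tensor_lift /= tensor_lift_pi free_lift_gen. Qed.

End TensorLift.

Lemma tensor_gen (R : comPzRingType) (C A : lmodType R) (S : submodule (tensor C A)) :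
  (forall c a, S (tens c a)) -> forall x, S x.
Proof.
move=> St; elim/quo_ind=> u.
pose S' := preim_submodule (quo_pi (span (@bilinear_rel R C A))) S.
suff: S' u by [].
apply: dirsum_gen => -[c a] r.
have -> : single (c, a) (r : R^o) = r *: free_gen R (c, a).
  apply: dirsumP => s; rewrite /free_gen /dcoef /=.
  rewrite [RHS](_ : _ = r * (if s == (c, a) then 1 else 0)) //.
  by case: ifP; rewrite ?mulr1 ?mulr0.
apply: submZ; exact: St.
Qed.

Section SubquotientClasses.
Variables (R : pzRingType) (V : lmodType R) (Z B : submodule V).

Definition scls (v : V) (Zv : Z v) : subquo Z B := quo_pi (pull Z B) (insubm_sub Zv).

Lemma scls_ex (x : subquo Z B) : exists v (Zv : Z v), x = scls Zv.
Proof.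
elim/quo_ind: x => v; exists (val v), (subm_prop v).
by congr (quo_pi _ _); apply: val_inj.
Qed.

Lemma scls_eq u v (Zu : Z u) (Zv : Z v) : scls Zu = scls Zv <-> B (u - v).
Proof. by split=> [/quo_eqP //|Buv]; apply/quo_eqP. Qed.

Lemma scls_eq0 u (Zu : Z u) : scls Zu = 0 <-> B u.
Proof.
rewrite (_ : 0 = scls (insubm0 Z)); last first.
  by rewrite /scls -(linear0 (quo_pi (pull Z B))); congr (quo_pi _ _); apply: val_inj.
by rewrite scls_eq subr0.
Qed.

Lemma scls_linear a u v (Zu : Z u) (Zv : Z v) (Zw : Z (a *: u + v)) :
  scls Zw = a *: scls Zu + scls Zv.
Proof. by rewrite -linearP; congr (quo_pi _ _); apply: val_inj. Qed.

End SubquotientClasses.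

Section SubquotientMaps.
Variables (R : pzRingType) (V V' : lmodType R).
Variables (Z B : submodule V) (Z' B' : submodule V') (f : {linear V -> V'}).
Hypothesis fZ : forall v, Z v -> Z' (f v).
Hypothesis fB : forall v, B v -> B' (f v).

Lemma subquo_map_scls v (Zv : Z v) : subquo_map B' fZ (scls B Zv) = scls B' (fZ Zv).
Proof.
apply/quo_eqP; rewrite /= -linearB; apply: fB.
have /quo_eqP := quo_reprK (scls B Zv).
by [].
Qed.

Fact subquo_map_linear : linear (subquo_map (B := B) B' fZ).
Proof.
move=> a x y; have [u [Zu ->]] := scls_ex x; have [v [Zv ->]] := scls_ex y.
rewrite -(scls_linear _ _ _ (insubmP a Zu Zv)) !subquo_map_scls.
have E := linearP f a u v.
rewrite -(scls_linear _ _ _ (insubmP a (fZ Zu) (fZ Zv))).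
by apply/scls_eq; rewrite E subrr; apply: insubm0.
Qed.
Definition subquo_lin : {linear subquo Z B -> subquo Z' B'} := mk_linear subquo_map_linear.

Lemma subquo_lin_scls v (Zv : Z v) : subquo_lin (scls B Zv) = scls B' (fZ Zv).
Proof. exact: subquo_map_scls. Qed.

End SubquotientMaps.

(** * Homogeneous cochains *)

Section ListCochains.
Variables (R : pzRingType) (T : Type) (W : lmodType R).
Implicit Types (F : seq T -> W) (s : seq T).

(* The homogeneous coboundary, an alternating sum over the deletions of one entry,
   in a recursive form that makes [dl_dl] and [prism_homotopy] plain list inductions. *)
Fixpoint dl F s : W :=
  if s is x :: s' then F s' - dl (fun u => F (x :: u)) s' else 0.

Lemma dlB F F' s : dl (fun u => F u - F' u) s = dl F s - dl F' s.
Proof.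
elim: s F F' => [|x s IH] F F' /=; first by rewrite subr0.
by rewrite IH !opprB addrACA [RHS]addrACA [- F' s + _]addrC.
Qed.

Lemma dl_dl F s : dl (dl F) s = 0.
Proof. by elim: s F => //= x s IH F; rewrite dlB IH subr0 subrr. Qed.

Lemma eq_dl n F F' s : (forall u, size u = n -> F u = F' u) ->
  size s = n.+1 -> dl F s = dl F' s.
Proof.
elim: s n F F' => //= x s IH n F F' FF' [sn]; rewrite FF' //; congr (_ - _).
case: n sn FF' => [|n] sn FF'; first by case: s sn {IH}.
by apply: (IH n) => // u un; apply: FF'; rewrite /= un.
Qed.

Lemma dl_sum F s :
  dl F s = \sum_(0 <= i < size s) (-1) ^+ i *: F (take i s ++ drop i.+1 s).
Proof.
elim: s F => [|x s IH] F; first by rewrite big_nil.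
rewrite /= IH big_nat_recl //= expr0 scale1r drop0; congr (_ + _).
rewrite -sumrN; apply: eq_bigr => i _ /=.
by rewrite exprS mulN1r scaleNr.
Qed.

Variable theta : T -> T.

(* The prism operator, with the alternating sum over the position at which one
   passes from [theta] to the identity unfolded along the list. *)
Fixpoint prism F s : W :=
  if s is x :: s' then F (theta x :: x :: s') - prism (fun u => F (theta x :: u)) s'
  else 0.

Lemma prismB F F' s : prism (fun u => F u - F' u) s = prism F s - prism F' s.
Proof.
elim: s F F' => [|x s IH] F F' /=; first by rewrite subr0.
by rewrite IH !opprB addrACA [RHS]addrACA [- F' _ + _]addrC.
Qed.

Lemma eq_prism n F F' s : (forall u, size u = n.+1 -> F u = F' u) ->
  size s = n -> prism F s = prism F' s.
Proof.
elim: s n F F' => //= x s IH n F F' FF' sn; subst n; rewrite FF' //; congr (_ - _).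
by apply: (IH (size s)) => // u un; apply: FF'; rewrite /= un.
Qed.

Lemma prism0 s : prism (fun=> 0) s = 0.
Proof. by elim: s => //= x s ->; rewrite subr0. Qed.

Lemma prism_homotopy F s : dl (prism F) s + prism (dl F) s = F s - F (map theta s).
Proof.
elim: s F => [|x s IH] F; first by rewrite /= subrr addr0.
have := IH (fun u => F (theta x :: u)).
rewrite /= dlB prismB => E.
(* What is left is an identity in an abelian group; its terms are made opaque before they are
   permuted. *)
move: (prism F s) (dl _ s) (dl _ s) (F (x :: s)) (F (theta x :: s)) (prism _ s) (F _) E.
move=> a b c d e f g E; rewrite !opprB !addrA.
rewrite (ACl (1*8*2*7*3*5*4*6)) -[LHS]/(a - a + c + f - b + b + d - g).
rewrite subrr add0r subrK E.
by rewrite addrAC [RHS]addrC [X in X + _]addrAC subrr sub0r.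
Qed.

End ListCochains.

Section LocalModules.
Variables (R : comPzRingType) (W : lmodType R).

Section Controlled.
Variables G H : groupType.

(** The second half of [coarse_map], kept apart because finiteness of point preimages concerns the
    finitely supported functions and not local modules in general. *)
Definition controlled (phi : G -> H) : Prop :=
  forall S : set (G * G), finite_set [set (p.1 * p.2^-1)%g | p in S] ->
  finite_set [set (phi p.1 * (phi p.2)^-1)%g | p in S].

(* The functions that agree on each piece of a finite partition of G with a
   pullback along [phi] of an element of [L]. *)
Definition pulled (phi : G -> H) (L : set (H -> W)) : set (G -> W) :=
  [set f | exists2 E : set (H -> W), finite_set E /\ E `<=` L &
    forall x, exists2 e, E e & f x = e (phi x)].

Lemma controlledP (phi : G -> H) (C : set G) : controlled phi -> finite_set C ->
  finite_set [set (phi p.1 * (phi p.2)^-1)%g | p in [set p | C (p.1 * p.2^-1)%g]].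
Proof.
move=> phiC Cf; apply: phiC; apply: sub_finite_set Cf.
by move=> _ [p Cp <-].
Qed.

End Controlled.

Section OneGroup.
Variable H : groupType.

(* Taking for [theta] the identity gives stability under cutting into pieces, and
   taking a translation gives invariance. *)
Definition local (L : set (H -> W)) : Prop :=
  forall theta : H -> H, close theta id -> pulled theta L `<=` L.

Lemma close_id : close (id : H -> H) id.
Proof.
apply: (@sub_finite_set _ _ [set 1%g]); last exact: finite_set1.
by move=> _ [x _ <-] /=; rewrite divgg.
Qed.

Lemma close_mulg g : close (fun x : H => (g * x)%g) id.
Proof.
apply: (@sub_finite_set _ _ [set g]); last exact: finite_set1.
by move=> _ [x _ <-] /=; rewrite mulgK.
Qed.

Record localmod := LocalMod { lsub :> submodule (H -> W); llocal : local lsub }.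

Variable L : localmod.

Lemma local_shift g f : L f -> L (fun y => f (g * y)%g).
Proof.
move=> Lf; apply: (llocal (close_mulg g)).
exists [set f]; last by move=> x; exists f.
by split; [exact: finite_set1|move=> _ ->].
Qed.

Definition shift g (f : subm L) : subm L := insubm_sub (local_shift g^-1%g (subm_prop f)).

Fact shift_linear g : linear (shift g).
Proof. by move=> a f f'; apply: val_inj. Qed.

Fact shift1 f : mk_linear (shift_linear 1%g) f = f.
Proof. by apply: val_inj; apply/funext => y /=; rewrite invg1 mul1g. Qed.

Fact shiftM g h f : mk_linear (shift_linear (g * h)%g) f =
  mk_linear (shift_linear g) (mk_linear (shift_linear h) f).
Proof. by apply: val_inj; apply/funext => y /=; rewrite invgM mulgA. Qed.

Definition fmod : gmodule R H := GModule shift1 shiftM.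

Lemma fmod_act g (f : fmod) y : val (gact fmod g f) y = val f (g^-1 * y)%g.
Proof. by []. Qed.

End OneGroup.
End LocalModules.

Section Homogenization.
Variables (H : groupType).

(** Bar coordinates of a simplex. The quotients are unchanged by right translation, which also
    preserves the coarse structure, so they describe the shape of the simplex without its base
    point. *)
Definition gdiff n (s : seq H) : gtuple H n :=
  [ffun j : 'I_n => (nth 1 s j * (nth 1 s j.+1)^-1)%g].

(* [gword t z] lists [z], [t_0^-1 z], [t_1^-1 t_0^-1 z], ...: the homogeneous simplex
   with first vertex [z] and bar coordinates [t]. *)
Fixpoint gword_at n (t : gtuple H n) (j : nat) : H :=
  if j is j'.+1 then
    ((if insub j' is Some i then t i else 1)^-1 * gword_at t j')%g
  else 1%g.

Definition gword n (t : gtuple H n) (z : H) : seq H :=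
  mkseq (fun j => gword_at t j * z)%g n.+1.

Lemma size_gword n (t : gtuple H n) z : size (gword t z) = n.+1.
Proof. exact: size_mkseq. Qed.

Lemma gwordE n (t : gtuple H n) z : gword t z = map (fun c => c * z)%g (gword t 1).
Proof. by rewrite /gword /mkseq -map_comp; apply: eq_map => j /=; rewrite mulg1. Qed.

Lemma gdiff_gword n (t : gtuple H n) z : gdiff n (gword t z) = t.
Proof.
apply/ffunP => j; have jn := ltn_ord j.
rewrite ffunE !nth_mkseq ?ltnS //; last exact: ltnW.
rewrite /= insubT /= invgM invgM invgK mulgA mulgA.
by rewrite mulgK mulgV mul1g; congr (t _); apply: val_inj.
Qed.

Lemma gword_gdiff n (s : seq H) : size s = n.+1 ->
  gword (gdiff n s) (nth 1%g s 0) = s.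
Proof.
move=> sn; apply: (@eq_from_nth _ 1%g); rewrite size_gword // => j jn.
rewrite nth_mkseq //; elim: j jn => [|j IH] jn; first by rewrite /= mul1g.
rewrite /= insubT ffunE -mulgA IH ?(ltnW jn) //= invgM invgK.
by rewrite mulgVK.
Qed.

Lemma gdiff_map n (w : seq H) z : size w = n.+1 ->
  gdiff n (map (fun c => c * z)%g w) = gdiff n w.
Proof.
move=> wn; apply/ffunP => j; have jn := ltn_ord j.
rewrite !ffunE !(nth_map 1%g) ?wn ?ltnS //; last exact: ltnW.
by rewrite invgM mulgA mulgK.
Qed.

Lemma nth_del (s : seq H) i j : (i < size s)%N ->
  nth 1%g (take i s ++ drop i.+1 s) j = nth 1%g s (bump i j).
Proof.
move=> si; rewrite nth_cat size_take si /bump; case: ltnP => ij.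
  by rewrite nth_take // leqNgt ij.
by rewrite nth_drop; congr nth; lia.
Qed.

(** Deleting an inner vertex telescopes the two quotients that meet there into their product;
    deleting an end vertex drops one quotient. *)
Lemma gdiff_face n (s : seq H) i : size s = n.+2 -> (i < n.+2)%N ->
  gdiff n (take i s ++ drop i.+1 s) = face i (gdiff n.+1 s).
Proof.
move=> sn i_lt; apply/ffunP => j; rewrite !ffunE !nth_del ?sn //= /bump.
case: (ltngtP j.+1 i) => [ji|ij|ij].
- by have -> : (i <= j)%N = false by lia.
- by have -> : (i <= j)%N by lia.
- have -> : (i <= j)%N = false by lia.
  rewrite /= mulgA. by rewrite mulgVK.
Qed.

End Homogenization.

Section HomogeneousCochains.
Variables (R : comPzRingType) (W : lmodType R).

Section OneGroup.
Variables (H : groupType) (L : localmod W H).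

(* Homogeneous [n]-cochains with values in [L]: along every simplex shape [w], the
   dependence on the base point belongs to [L]. *)
Definition adm n (F : seq H -> W) : Prop :=
  forall w, size w = n.+1 -> L (fun z => F (map (fun c => c * z)%g w)).

(** As Hom_H(R[H^(n+1)], Map(H, W)) = Map(H^(n+1), W), evaluation uses up the equivariance. No
    invariance condition on [homog f] remains, so a map that is no homomorphism can act by
    composition. *)
Definition homog n (f : cochain (fmod L) n) (s : seq H) : W :=
  val (f (gdiff n s)) (nth 1%g s 0).

Lemma homog_adm n (f : cochain (fmod L) n) : adm n (homog f).
Proof.
move=> w wn; rewrite (_ : (fun z => _) = (fun z => val (f (gdiff n w)) (nth 1%g w 0 * z)%g)).
  exact/local_shift/subm_prop.
by apply/funext => z; rewrite /homog gdiff_map // (nth_map 1%g) ?wn.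
Qed.

Lemma homog_gword n (f : cochain (fmod L) n) t z : homog f (gword t z) = val (f t) z.
Proof. by rewrite /homog gdiff_gword nth_mkseq // mul1g. Qed.

Lemma homog_inj n (f f' : cochain (fmod L) n) :
  (forall s, size s = n.+1 -> homog f s = homog f' s) -> f = f'.
Proof.
move=> ff'; apply/funext => t; apply: val_inj; apply/funext => z.
by rewrite -!homog_gword ff' // size_gword.
Qed.

Definition inhomog n F (aF : adm n F) : cochain (fmod L) n :=
  fun t => insubm_sub (aF (gword t 1%g) (size_gword t 1%g)).

Lemma inhomogE n F (aF : adm n F) t z : val (inhomog aF t) z = F (gword t z).
Proof. by rewrite [in RHS]gwordE. Qed.

Lemma homog_inhomog n F (aF : adm n F) s : size s = n.+1 -> homog (inhomog aF) s = F s.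
Proof. by move=> sn; rewrite /homog inhomogE gword_gdiff. Qed.

(** Acting by the first bar coordinate moves the base point from vertex 0 to vertex 1, the first
    vertex left when vertex 0 is deleted. The other deletions keep vertex 0. *)
Lemma homog_cobd n (f : cochain (fmod L) n) s : size s = n.+2 ->
  homog (cobd f) s = dl (homog f) s.
Proof.
move=> sn; rewrite dl_sum sn big_nat_recl // expr0 scale1r big_mkord.
rewrite /homog /cobd.
have valD (u v : subm L) z : val (u + v) z = val u z + val v z by [].
have val0 z : val (0 : subm L) z = 0 by [].
rewrite valD (big_morph (fun u : subm L => val u (nth 1%g s 0))
  (fun u v => valD u v _) (val0 _)).
congr (_ + _).
  rewrite fmod_act -gdiff_face ?sn // nth_del ?sn // ffunE /= /bump /=; congr (val _ _).
  by rewrite invgM invgK mulgVK.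
apply: eq_bigr => i _; have i_lt := ltn_ord i.
by rewrite -gdiff_face ?sn // nth_del ?sn.
Qed.

Lemma homogB n (f f' : cochain (fmod L) n) s : homog (f - f') s = homog f s - homog f' s.
Proof. by []. Qed.

Lemma homog0 n s : homog (0 : cochain (fmod L) n) s = 0.
Proof. by []. Qed.

Lemma fmod_cobd_cobd n (f : cochain (fmod L) n) : cobd (cobd f) = 0.
Proof.
apply: homog_inj => s sn; rewrite homog_cobd // homog0 -(dl_dl (homog f) s).
by apply: eq_dl sn => u un; rewrite homog_cobd.
Qed.

End OneGroup.
End HomogeneousCochains.

(** * Pullback along coarse maps *)

Lemma finite_words (T : choiceType) (C : set T) n : finite_set C ->
  finite_set [set w : seq T | size w = n /\ forall x, x \in w -> C x].
Proof.
move=> Cf; elim: n => [|n IH].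
  apply: (@sub_finite_set _ _ [set [::]]); last exact: finite_set1.
  by move=> w [/size0nil ->].
set B := [set w | _] in IH.
apply: (@sub_finite_set _ _ [set p.1 :: p.2 | p in C `*` B]).
  move=> [|x w] [] //= [sw] wC; exists (x, w) => //=; split; first exact/wC/mem_head.
  by split=> // y yw; apply: wC; rewrite inE yw orbT.
exact/finite_image/finite_setX.
Qed.

Section Pullback.
Variables (R : comPzRingType) (W : lmodType R).

(** Relative to [phi y], the points of [q y] lie in the finite set [C], so only finitely many
    simplex shapes occur; each contributes one element of [L]. *)
Lemma adm_pulled (G H : groupType) (L : localmod W H) n F (phi : G -> H)
    (C : set H) (q : G -> seq H) :
  adm L n F -> finite_set C -> (forall y, size (q y) = n.+1) ->
  (forall y x, x \in q y -> C (x * (phi y)^-1)%g) ->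
  pulled phi L (fun y => F (q y)).
Proof.
move=> FL Cf qn qC.
exists [set (fun z => F (map (fun c => c * z)%g w)) | w in
    [set w : seq H | size w = n.+1 /\ forall x, x \in w -> C x]].
  split; first exact/finite_image/finite_words.
  by move=> _ [w [wn _] <-]; apply: FL.
move=> y; exists (fun z => F (map (fun c => c * z)%g (map (fun c => c * (phi y)^-1)%g (q y)))).
  exists (map (fun c => c * (phi y)^-1)%g (q y)) => //; split; first by rewrite size_map.
  by move=> _ /mapP[x xq ->]; apply: qC.
congr F; rewrite -map_comp -[LHS]map_id; apply: eq_map => x /=.
by rewrite mulgVK.
Qed.

Section CochainPullback.
Variables (G H : groupType) (phi : G -> H) (L : localmod W H) (L' : localmod W G).
Hypotheses (phiC : controlled phi) (phiL : pulled phi L `<=` L').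

Lemma pull_adm n F : adm L n F -> adm L' n (fun s => F (map phi s)).
Proof.
move=> FL w wn; apply: phiL.
have wf : finite_set [set x | x \in w] by apply/finite_seqP; exists w.
apply: (adm_pulled FL (controlledP phiC wf)) => [y|y x]; first by rewrite !size_map.
move=> /mapP[_ /mapP[c cw ->] ->]; exists ((c * y)%g, y) => //=.
by rewrite mulgK.
Qed.

Definition pull_cochain n (f : cochain (fmod L) n) : cochain (fmod L') n :=
  inhomog (pull_adm (homog_adm f)).

Lemma homog_pull n (f : cochain (fmod L) n) s : size s = n.+1 ->
  homog (pull_cochain f) s = homog f (map phi s).
Proof. exact: homog_inhomog. Qed.

Fact pull_cochain_linear n : linear (@pull_cochain n).
Proof. by move=> a f g; apply/funext => t; apply: val_inj. Qed.

Lemma dl_map F s : dl (fun u => F (map phi u)) s = dl F (map phi s) :> W.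
Proof. by elim: s F => //= x s IH F; rewrite (IH (fun u => F (phi x :: u))). Qed.

Lemma pull_cobd n (f : cochain (fmod L) n) : pull_cochain (cobd f) = cobd (pull_cochain f).
Proof.
apply: homog_inj => s sn; rewrite homog_pull // !homog_cobd ?size_map // -dl_map.
by apply: eq_dl sn => u un; rewrite homog_pull.
Qed.

Lemma pull_cocycle n (f : cochain (fmod L) n) :
  cocycle _ n f -> cocycle _ n (pull_cochain f).
Proof.
rewrite /= /is_cocycle -pull_cobd => ->.
exact: (raddf0 (mk_linear (@pull_cochain_linear n.+1))).
Qed.

Lemma pull_coboundary n (f : cochain (fmod L) n) :
  coboundary _ n f -> coboundary _ n (pull_cochain f).
Proof.
case: n f => [|n] f /=; first by move=> ->; exact: (raddf0 (mk_linear (@pull_cochain_linear 0))).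
by move=> [e ->]; exists (pull_cochain e); rewrite pull_cobd.
Qed.

Definition pull_coh (n : nat) : {linear Hcoh (fmod L) n -> Hcoh (fmod L') n} :=
  @subquo_lin R _ _ _ (coboundary _ n) _ (coboundary _ n) (mk_linear (@pull_cochain_linear n))
    (@pull_cocycle n) (@pull_coboundary n).

Lemma pull_coh_scls n (f : cochain (fmod L) n) (fZ : cocycle _ n f) :
  pull_coh n (scls _ fZ) = scls _ (pull_cocycle fZ).
Proof. exact: subquo_lin_scls. Qed.

End CochainPullback.

Section Homotopy.
Variables (H : groupType) (L : localmod W H) (theta : H -> H).
Hypothesis thetaC : close theta id.

(** The recursion of [prism] pushes transformed vertices into a prefix. The statement is therefore
    generalized to a prefix [q z] that varies with [z] but stays in a finite set [C] relative to
    [z]. *)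
Lemma prism_adm_prefix n F (C : set H) (q : H -> seq H) w : adm L n.+1 F -> finite_set C ->
  (forall z, (size (q z) + size w)%N = n.+1) ->
  (forall z x, x \in q z -> C (x * z^-1)%g) ->
  L (fun z => prism theta (fun u => F (q z ++ u)) (map (fun c => c * z)%g w)).
Proof.
move=> FL; elim: w C q => [|c w IH] C q Cf qn qC /=; first exact: (insubm0 L).
(* [theta (c z) z^-1] is [theta (c z) (c z)^-1] times [c], and the first factor takes finitely many
   values. *)
pose C' := C `|` [set (p * c)%g | p in [set (theta x * (id x)^-1)%g | x in [set: H]]].
have C'f : finite_set C' by rewrite finite_setU; split=> //; apply: finite_image.
have thC' z : C' (theta (c * z) * z^-1)%g.
  by right; exists (theta (c * z) * (c * z)^-1)%g; [exists (c * z)%g|rewrite invgM mulgA mulgVK].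
apply: (submB (S := L)).
  apply: (llocal (close_id H)).
  have wf : finite_set [set x | x \in c :: w] by apply/finite_seqP; exists (c :: w).
  apply: (adm_pulled (C := C' `|` [set x | x \in c :: w]) FL).
  - by rewrite finite_setU; split.
  - by move=> y; rewrite size_cat /= size_map -(qn y) /=; lia.
  - move=> y x; rewrite mem_cat => /orP[/qC Cx|]; first by left; left.
    rewrite inE => /orP[/eqP ->|]; first by left.
    rewrite -[_ :: _]/(map (fun c => c * y)%g (c :: w)) => /mapP[d dw ->].
    by right; rewrite /= mulgK.
rewrite (_ : (fun z => _) = fun z => prism theta (fun u => F (rcons (q z) (theta (c * z)%g) ++ u))
    (map (fun c => c * z)%g w)); last first.
  by apply/funext => z; congr (prism _ _ _); apply/funext => u; rewrite cat_rcons.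
apply: (IH C') => // [z|z x]; first by rewrite size_rcons -(qn z) /=; lia.
by rewrite mem_rcons inE => /orP[/eqP ->|/qC]; last by left.
Qed.

Lemma prism_adm n F : adm L n.+1 F -> adm L n (prism theta F).
Proof.
move=> FL w wn; apply: (prism_adm_prefix (C := set0) (q := fun=> [::]) FL) => //.
Qed.

Lemma homotopic_coboundary n (f f' : cochain (fmod L) n) : cocycle _ n f ->
  (forall s, size s = n.+1 -> homog f' s = homog f (map theta s)) ->
  coboundary _ n (f - f').
Proof.
rewrite /= /is_cocycle => df ff'.
have E s : size s = n.+1 -> homog (f - f') s = dl (prism theta (homog f)) s.
  move=> sn; rewrite homogB ff' // -prism_homotopy.
  rewrite [X in _ + X](_ : _ = 0) ?addr0 //.
  rewrite (@eq_prism _ _ _ _ n.+1 _ (fun=> 0)) ?prism0 // => u un.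
  by rewrite -homog_cobd // df homog0.
case: n f f' df ff' E => [|n] f f' df ff' E.
  (* In degree 0 the only coboundary is 0, and [E] already gives equality, since [prism] is 0 on the
     empty list. *)
  apply: homog_inj => s sn; rewrite E // homog0.
  by case: s sn => [|x [|y s]] //= _; rewrite subr0.
exists (inhomog (prism_adm (homog_adm f))); apply: homog_inj => s sn.
rewrite E // homog_cobd //; apply: eq_dl sn => u un.
by rewrite homog_inhomog.
Qed.

End Homotopy.

Section CoarseEquivalence.
Variables (G H : groupType) (phi : G -> H) (psi : H -> G).
Hypotheses (phiC : controlled phi) (psiC : controlled psi).
Hypothesis phipsi : close (phi \o psi) id.
Variables (L : localmod W H) (L' : localmod W G).
Hypotheses (phiL : pulled phi L `<=` L') (psiL : pulled psi L' `<=` L).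

Lemma pull_cohK n : cancel (pull_coh phiC phiL n) (pull_coh psiC psiL n).
Proof.
move=> x; have [f [fZ ->]] := scls_ex x.
rewrite !pull_coh_scls; apply/esym/scls_eq.
apply: (homotopic_coboundary phipsi) => // s sn.
by rewrite homog_pull // homog_pull ?size_map // -map_comp.
Qed.

End CoarseEquivalence.
End Pullback.

(** * Induced modules *)

Section PointwiseMap.
Variables (R : pzRingType) (T : choiceType).

Fact dmap_finsupported (M N : lmodType R) (f : {linear M -> N}) (x : dirsum T M) :
  finsupp_submodule T N (fun t => f (dcoef x t)).
Proof.
apply: sub_finite_set (subm_prop x) => t /=.
by apply: contraNN => /eqP xt; rewrite (xt : dcoef x t = 0) linear0.
Qed.
Definition dmap_fun (M N : lmodType R) (f : {linear M -> N}) (x : dirsum T M) : dirsum T N :=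
  insubm_sub (dmap_finsupported f x).

Fact dmap_linear (M N : lmodType R) (f : {linear M -> N}) : linear (dmap_fun f).
Proof. by move=> a x y; apply: dirsumP => t; rewrite dcoef_linear /dcoef /= linearP. Qed.
Definition dmap (M N : lmodType R) (f : {linear M -> N}) : {linear dirsum T M -> dirsum T N} :=
  mk_linear (dmap_linear f).

Lemma dcoef_dmap (M N : lmodType R) (f : {linear M -> N}) x t : dcoef (dmap f x) t = f (dcoef x t).
Proof. by []. Qed.

Lemma dmap_single (M N : lmodType R) (f : {linear M -> N}) t m :
  dmap f (single t m) = single t (f m).
Proof.
apply: dirsumP => s; rewrite dcoef_dmap /dcoef /=.
by case: ifP => // _; rewrite linear0.
Qed.

Lemma dmap_comp (M N P : lmodType R) (f : {linear N -> P}) (g : {linear M -> N})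
    (h : {linear M -> P}) x : (forall m, f (g m) = h m) -> dmap f (dmap g x) = dmap h x.
Proof. by move=> fgh; apply: dirsumP => s; rewrite !dcoef_dmap. Qed.

Lemma dmap_id (M : lmodType R) (f : {linear M -> M}) x : (forall m, f m = m) -> dmap f x = x.
Proof. by move=> fid; apply: dirsumP => s; rewrite dcoef_dmap. Qed.

End PointwiseMap.

Section Induced.
Variables (R : comPzRingType).

Section Modules.
Variable (G : groupType).

(** Finite point preimages keep supports finite: the support of [f] lies over the supports of
    finitely many pieces. *)
Lemma pulled_finsupp (H : groupType) (M : lmodType R) (phi : G -> H) :
  (forall y, finite_set (phi @^-1` [set y])) ->
  pulled phi (finsupp_submodule H M) `<=` finsupp_submodule G M.
Proof.
move=> phif f [E [Ef Es] fE].
apply: (@sub_finite_set _ _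
  (\bigcup_(e in E) \bigcup_(y in [set y | e y != 0]) (phi @^-1` [set y]))).
  move=> x /= fx; have [e Ee fxe] := fE x.
  by exists e => //; exists (phi x) => //=; rewrite -fxe.
apply: bigcup_finite => // e /Es ef.
by apply: bigcup_finite.
Qed.

(** A map close to the identity has finite fibres: if [theta x = y], then [x = c^-1 y] with
    [c = theta x x^-1] in a finite set. *)
Lemma finsupp_local (M : lmodType R) : local (finsupp_submodule G M).
Proof.
move=> theta thC; apply: pulled_finsupp => y.
apply: sub_finite_set (finite_image (fun c => c^-1 * y)%g thC).
move=> x /= <-; exists (theta x * (id x)^-1)%g; first by exists x.
by rewrite /= invgM invgK mulgVK.
Qed.

Definition indloc (M : lmodType R) : localmod M G := LocalMod (@finsupp_local M).

(* The induced module [RG (x)_R M], as finitely supported functions. *)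
Definition ind (M : lmodType R) : gmodule R G := fmod (indloc M).

Lemma ind_act_single (M : lmodType R) g (t : G) (m : M) :
  gact (ind M) g (single t m) = single (g * t)%g m.
Proof.
apply: dirsumP => s; rewrite /dcoef /= /single /=.
congr (if _ then _ else _); apply/eqP/eqP => [<-|->].
  by rewrite mulVKg.
by rewrite mulKg.
Qed.

Fact ind_map_act (M N : lmodType R) (f : {linear M -> N}) g (x : ind M) :
  dmap G f (gact (ind M) g x) = gact (ind N) g (dmap G f x).
Proof. exact: dirsumP. Qed.
Definition ind_map (M N : lmodType R) (f : {linear M -> N}) : ghom (ind M) (ind N) :=
  @GHom R G (ind M) (ind N) (dmap G f) (ind_map_act f).

Section Adjoint.
Variables (M : lmodType R) (B : gmodule R G) (f : {linear M -> B}).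

Definition ind_ext_lin : {linear dirsum G M -> B} :=
  dlin (fun t => gact B t \o f : {linear M -> B}).

Fact ind_ext_act g (x : ind M) : ind_ext_lin (gact (ind M) g x) = gact B g (ind_ext_lin x).
Proof.
apply: (@dirsum_linear_ext _ _ _ _ (ind_ext_lin \o gact (ind M) g)
  (gact B g \o ind_ext_lin)) => t m.
rewrite -[LHS]/(ind_ext_lin (gact (ind M) g (single t m))) ind_act_single.
rewrite -[RHS]/(gact B g (ind_ext_lin (single t m))) !dlin_single /=.
by rewrite gactM.
Qed.
Definition ind_ext : ghom (ind M) B := @GHom R G (ind M) B ind_ext_lin ind_ext_act.

Lemma ind_ext_single t m : ind_ext (single t m) = gact B t (f m).
Proof. exact: dlin_single. Qed.

End Adjoint.
End Modules.
End Induced.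

(** * The differentials square to zero *)

Section CobdCobd.
Variables (R : comPzRingType) (G : groupType).

(* Mapping [A] into the functions [G -> A], where the action is by translation only,
   reduces [cobd_cobd] to the homogeneous case. *)
Section AllFunctions.
Variable A : gmodule R G.

Fact all0 : True. Proof. by []. Qed.
Fact allP (a : R) (f g : G -> A) : True -> True -> True. Proof. by []. Qed.
Definition all_submodule : submodule (G -> A) :=
  @Submodule R (G -> A) (fun=> True) all0 allP.
Definition allloc : localmod A G := @LocalMod R A G all_submodule (fun _ _ _ _ => I).

Definition orbit_fun (a : A) : subm allloc :=
  @insubm_sub R (G -> A) allloc (fun y => gact A y^-1%g a) I.
Fact orbit_fun_linear : linear orbit_fun.
Proof. by move=> r a b; apply: val_inj; apply/funext => y /=; rewrite linearP. Qed.
Fact orbit_fun_act g a : mk_linear orbit_fun_linear (gact A g a) =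
  gact (fmod allloc) g (mk_linear orbit_fun_linear a).
Proof. by apply: val_inj; apply/funext => y /=; rewrite -gactM invgM invgK. Qed.
Definition orbit_hom : ghom A (fmod allloc) :=
  @GHom R G A (fmod allloc) (mk_linear orbit_fun_linear) orbit_fun_act.

Lemma cobd_cobd n (f : cochain A n) : cobd (cobd f) = 0.
Proof.
have oI (a : A) : orbit_hom a = 0 -> a = 0.
  by move=> /(congr1 (fun u : subm allloc => val u 1%g)) /=; rewrite invg1 gact1.
apply/funext => t; apply: oI.
rewrite -[LHS]/(cochain_map orbit_hom (cobd (cobd f)) t) !cochain_map_cobd.
by rewrite fmod_cobd_cobd.
Qed.

End AllFunctions.

Section BdBd.
Variables (M : gmodule R G) (W : lmodType R).

(** Arbitrary maps from [M] to [W] are allowed, not only linear ones: [cobd_cobd] holds for any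
    module of coefficients, and this one needs no submodule of linear maps. *)
Definition contra_act (g : G) (f : M -> W) : M -> W := fun m => f (gact M g^-1%g m).
Fact contra_act_linear g : linear (contra_act g). Proof. by []. Qed.
Fact contra_act1 f : mk_linear (contra_act_linear 1%g) f = f.
Proof. by apply/funext => m; rewrite /= /contra_act invg1 gact1. Qed.
Fact contra_actM g h f : mk_linear (contra_act_linear (g * h)%g) f =
  mk_linear (contra_act_linear g) (mk_linear (contra_act_linear h) f).
Proof. by apply/funext => m; rewrite /= /contra_act invgM gactM. Qed.
Definition contra : gmodule R G := GModule contra_act1 contra_actM.

(* Linear maps out of chains with coefficients in M are cochains with values in the
   maps from M, and precomposition with [bd] becomes [cobd]. *)
Lemma cobd_pairing n (u : {linear chain M n -> W}) (t : gtuple G n.+1) m :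
  (@cobd R G contra n (fun s (m : M) => u (single s m) : W) t : M -> W) m = u (bd (single t m)).
Proof.
rewrite /bd dext_single; last exact: bd_single_linear.
rewrite /bd_single linearD linear_sum.
have contraD (f g : contra) : (f + g) m = f m + g m by [].
rewrite /cobd contraD; congr (_ + _).
rewrite (big_morph (fun f : contra => f m) contraD (erefl : (0 : contra) m = 0)).
by apply: eq_bigr => i _; rewrite linearZ_LR.
Qed.

End BdBd.

(** The universal cochain [c], with [c s m = single s m], turns [cobd] into [bd] on generators;
    doing this twice transports [cobd_cobd]. *)
Lemma bd_bd (M : gmodule R G) n (x : chain M n.+2) : bd (bd x) = 0.
Proof.
apply: (@dirsum_linear_ext _ _ _ _ (@bd _ _ M n \o @bd _ _ M n.+1) (\0)) => t m.
pose c : cochain (contra M (chain M n)) n := fun s (m : M) => single s m.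
have E : cobd c = (fun s (m : M) => bd (single s m)) :> cochain (contra M (chain M n)) n.+1.
  by apply/funext => s; apply/funext => m'; rewrite (cobd_pairing idfun).
transitivity ((cobd (cobd c) t : M -> chain M n) m); last by rewrite cobd_cobd.
by rewrite E (cobd_pairing (@bd _ _ M n)).
Qed.

End CobdCobd.

(** * Split exact sequences of coefficients *)

Section CohomologyMaps.
Variables (R : comPzRingType) (G : groupType).
Implicit Types A B : gmodule R G.

Definition coh_vanishes A n : Prop :=
  forall f : cochain A n, cocycle A n f -> coboundary A n f.

Lemma coh_vanishesP A (n : nat) : coh_vanishes A n <-> forall x : Hcoh A n, x = 0.
Proof.
split=> [A0 x|A0 f fZ].
  by have [f [fZ ->]] := scls_ex x; apply/scls_eq0; apply: A0.
exact/(scls_eq0 _ fZ)/A0.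
Qed.

Definition hcoh A B (f : ghom A B) (n : nat) : {linear Hcoh A n -> Hcoh B n} :=
  @subquo_lin R _ _ _ (coboundary A n) _ (coboundary B n) (@cochain_map R G A B f n)
    (@cochain_map_cocycle R G A B f n) (@cochain_map_coboundary R G A B f n).

Lemma hcohE A B (f : ghom A B) (n : nat) (x : Hcoh A n) : Hcoh_map f x = hcoh f n x.
Proof. by []. Qed.

Lemma hcoh_scls A B (f : ghom A B) n (c : cochain A n) (cZ : cocycle A n c) :
  hcoh f n (scls _ cZ) = scls _ (cochain_map_cocycle f cZ).
Proof. exact: subquo_lin_scls. Qed.

Lemma eq_hcoh A B (f g : ghom A B) n : f =1 g -> hcoh f n =1 hcoh g n.
Proof.
move=> fg x; have [c [cZ ->]] := scls_ex x; rewrite !hcoh_scls; apply/scls_eq.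
rewrite (_ : cochain_map f c = cochain_map g c) ?subrr; first exact: insubm0.
by apply/funext => t; apply: fg.
Qed.

Lemma hcoh_id A (f : ghom A A) n : f =1 id -> hcoh f n =1 id.
Proof.
move=> fid x; have [c [cZ ->]] := scls_ex x; rewrite !hcoh_scls; apply/scls_eq.
rewrite (_ : cochain_map f c = c) ?subrr; first exact: insubm0.
by apply/funext => t; apply: fid.
Qed.

Lemma hcoh_comp A B C (f : ghom B C) (g : ghom A B) (h : ghom A C) n :
  (forall a, f (g a) = h a) -> forall x, hcoh f n (hcoh g n x) = hcoh h n x.
Proof.
move=> fgh x; have [c [cZ ->]] := scls_ex x; rewrite !hcoh_scls; apply/scls_eq.
have -> : cochain_map f (cochain_map g c) = cochain_map h c.
  by apply/funext => t; apply: fgh.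
by rewrite subrr; apply: insubm0.
Qed.

Lemma coh_vanishes_retract A B (i : ghom A B) (p : ghom B A) n :
  (forall a, p (i a) = a) -> coh_vanishes B n -> coh_vanishes A n.
Proof.
move=> pi /coh_vanishesP B0; apply/coh_vanishesP => x.
pose idA := @GHom R G A A idfun (fun _ _ => erefl).
have <- : hcoh p n (hcoh i n x) = x.
  by rewrite (@hcoh_comp _ _ _ p i idA) // hcoh_id.
by rewrite (B0 (hcoh i n x)) raddf0.
Qed.

End CohomologyMaps.

Section PullCohomology.
Variables (R : comPzRingType) (G H : groupType) (phi : G -> H).
Hypothesis phiC : coarse_map phi.

Definition pull_ind (M : lmodType R) (n : nat) :
    {linear Hcoh (ind H M) n -> Hcoh (ind G M) n} :=
  @pull_coh R M G H phi (indloc H M) (indloc G M) phiC.2 (@pulled_finsupp R G H M phi phiC.1) n.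

Lemma pull_ind_scls M (n : nat) (c : cochain (ind H M) n) (cZ : cocycle _ n c) :
  pull_ind M n (scls _ cZ) =
  scls _ (@pull_cocycle R M G H phi (indloc H M) (indloc G M) phiC.2
    (@pulled_finsupp R G H M phi phiC.1) n c cZ).
Proof. exact: pull_coh_scls. Qed.

Lemma pull_ind_natural (M N : lmodType R) (g : {linear M -> N}) (n : nat)
    (x : Hcoh (ind H M) n) :
  hcoh (ind_map G g) n (pull_ind M n x) = pull_ind N n (hcoh (ind_map H g) n x).
Proof.
have [c [cZ ->]] := scls_ex x.
rewrite pull_ind_scls (hcoh_scls (ind_map G g)) (hcoh_scls (ind_map H g)) pull_ind_scls.
apply/scls_eq; rewrite [X in X - _](_ : _ = pull_cochain phiC.2
    (L := indloc H N) (L' := indloc G N) (@pulled_finsupp R G H N phi phiC.1)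
    (cochain_map (ind_map H g) c)) ?subrr; first exact: insubm0.
by apply/funext => t; apply: dirsumP => z.
Qed.

End PullCohomology.

Lemma pull_ind_bij (R : comPzRingType) (G H : groupType) (phi : G -> H) (psi : H -> G)
    (phiC : coarse_map phi) (psiC : coarse_map psi) (M : lmodType R) n :
  close (phi \o psi) id -> close (psi \o phi) id ->
  bijective (@pull_ind R G H phi phiC M n).
Proof. by move=> pp pp'; exists (pull_ind psiC M n); apply: pull_cohK. Qed.

(** [ses_s] and [ses_r] are only R-linear. Carrying them as data makes the connecting maps explicit,
    as retraction after differential after section, and lets additive functors preserve the
    sequence. *)
Record split_ses (R : comPzRingType) (G : groupType) (K F A : gmodule R G) := SplitSes {
  ses_i : ghom K F;
  ses_p : ghom F A;
  ses_s : {linear A -> F};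
  ses_r : {linear F -> K};
  ses_ps : forall a, ses_p (ses_s a) = a;
  ses_ri : forall k, ses_r (ses_i k) = k;
  ses_split : forall f, ses_i (ses_r f) + ses_s (ses_p f) = f
}.

Section SplitSes.
Variables (R : comPzRingType) (G : groupType) (K F A : gmodule R G).
Variable E : split_ses K F A.

Lemma ses_pi k : ses_p E (ses_i E k) = 0.
Proof.
have := ses_split E (ses_i E k); rewrite ses_ri -[RHS]addr0.
by move=> /addrI /(congr1 (ses_p E)); rewrite ses_ps raddf0.
Qed.

Section Cohomology.
Implicit Types n : nat.

Definition post (U V : lmodType R) (f : {linear U -> V}) n (c : gtuple G n -> U) :
  gtuple G n -> V := fun t => f (c t).

Fact post_linear (U V : gmodule R G) (f : {linear U -> V}) n :
  linear (@post U V f n : cochain U n -> cochain V n).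
Proof. by move=> a c d; apply/funext => t; rewrite /post linearP. Qed.

Definition delta n (f : cochain A n) : cochain K n.+1 :=
  post (ses_r E) (cobd (post (ses_s E) f : cochain F n)).

Fact delta_linear n : linear (@delta n).
Proof. by move=> a f g; rewrite /delta post_linear cobd_linear post_linear. Qed.

Let i n : cochain K n -> cochain F n := @cochain_map R G K F (ses_i E) n.
Let p n : cochain F n -> cochain A n := @cochain_map R G F A (ses_p E) n.
Let s n (c : cochain A n) : cochain F n := post (ses_s E) c.
Let r n (c : cochain F n) : cochain K n := post (ses_r E) c.

Let ps n (c : cochain A n) : p (s c) = c.
Proof. by apply/funext => t; apply: ses_ps. Qed.
Let ri n (c : cochain K n) : r (i c) = c.
Proof. by apply/funext => t; apply: ses_ri. Qed.
Let pi n (c : cochain K n) : p (i c) = 0.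
Proof. by apply/funext => t; apply: ses_pi. Qed.
Let split n (c : cochain F n) : i (r c) + s (p c) = c.
Proof. by apply/funext => t; apply: ses_split. Qed.
Let iI n : injective (@i n). Proof. exact: (can_inj (@ri n)). Qed.
Let dp n (c : cochain F n) : cobd (p c) = p (cobd c).
Proof. by rewrite /p cochain_map_cobd. Qed.
Let di n (c : cochain K n) : cobd (i c) = i (cobd c).
Proof. by rewrite /i cochain_map_cobd. Qed.
Let dB (B : gmodule R G) n (c d : cochain B n) : cobd (c - d) = cobd c - cobd d.
Proof. exact: (linearB (@cobd R G B n)). Qed.
Let dN (B : gmodule R G) n (c : cochain B n) : cobd (- c) = - cobd c.
Proof. exact: (linearN (@cobd R G B n)). Qed.
Let pB n (c d : cochain F n) : p (c - d) = p c - p d.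
Proof. by apply/funext => t; apply: raddfB. Qed.
Let s0 n : s (0 : cochain A n) = 0.
Proof. by apply/funext => t; apply: raddf0. Qed.
Let rB n (c d : cochain F n) : r (c - d) = r c - r d.
Proof. by apply/funext => t; apply: raddfB. Qed.

Lemma delta_i n (f : cochain A n) : cobd f = 0 -> i (delta f) = cobd (s f).
Proof.
move=> df; rewrite -[RHS]split -dp ps df s0 addr0.
by [].
Qed.

Lemma delta_cocycle n (f : cochain A n) : cocycle A n f -> cocycle K n.+1 (delta f).
Proof.
move=> df; apply: iI; rewrite -di delta_i // cobd_cobd.
by apply/esym/funext => t; apply: raddf0.
Qed.

Lemma delta_coboundary n (f : cochain A n) : coboundary A n f -> coboundary K n.+1 (delta f).
Proof.
case: n f => [|n] f /=.
  move=> ->; exists 0; rewrite /delta -/(s _) s0 !raddf0 -/(r _).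
  by apply/funext => t; apply: raddf0.
(* The section fails to commute with [cobd] by [i (r (cobd (s e)))], as [cobd (s e)] lifts [cobd e];
   this gives the witness. *)
move=> [e ->]; exists (- r (cobd (s e))); rewrite /delta -/(s _) -/(r _).
have -> : s (cobd e) = cobd (s e) - i (r (cobd (s e))).
  by rewrite -[X in X - _]split -dp ps addrAC subrr add0r.
rewrite dB cobd_cobd di.
rewrite sub0r dN -[in RHS](ri (cobd _)).
by apply/funext => t; apply: raddfN.
Qed.

Definition hdelta n : {linear Hcoh A n -> Hcoh K n.+1} :=
  @subquo_lin R _ _ _ (coboundary A n) _ (coboundary K n.+1) (mk_linear (@delta_linear n))
    (@delta_cocycle n) (@delta_coboundary n).

Lemma hdelta_scls n (c : cochain A n) (cZ : cocycle A n c) :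
  hdelta n (scls _ cZ) = scls _ (delta_cocycle cZ).
Proof. exact: subquo_lin_scls. Qed.

Lemma delta_lift n (f : cochain A n) : cocycle A n f -> coboundary K n.+1 (delta f) ->
  exists2 g : cochain F n, cocycle F n g & p g = f.
Proof.
move=> df [e de]; exists (s f - i e).
  by rewrite /= /is_cocycle dB di -de delta_i // subrr.
by rewrite pB ps pi subr0.
Qed.

Lemma hdelta_inj n : coh_vanishes F n -> injective (hdelta n).
Proof.
move=> F0; apply: linear_inj_of_ker => x; have [f [fZ ->]] := scls_ex x.
rewrite hdelta_scls => /scls_eq0 /(delta_lift fZ)[g /F0 gB gf].
by apply/scls_eq0; rewrite -gf; apply: cochain_map_coboundary.
Qed.

Lemma hdelta_image n y : (exists x, hdelta n x = y) <-> hcoh (ses_i E) n.+1 y = 0.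
Proof.
split=> [[x <-]|].
  have [f [fZ ->]] := scls_ex x; rewrite hdelta_scls hcoh_scls; apply/scls_eq0.
  by exists (s f); rewrite -delta_i.
have [c [cZ ->]] := scls_ex y; rewrite hcoh_scls => /scls_eq0 [u iu].
have pu : cocycle A n (p u) by rewrite /= /is_cocycle dp -iu; apply: pi.
(* If [i c = cobd u], then [p u] is a cocycle, and [delta (p u)] differs from [c] by the coboundary
   of [- r u]. *)
exists (scls _ pu); rewrite hdelta_scls; apply/scls_eq; exists (- r u).
rewrite /delta -/(s _) -/(r _).
have -> : s (p u) = u - i (r u) by rewrite -[X in X - _]split addrAC subrr add0r.
rewrite dB di -iu rB !ri.
by rewrite dN addrAC subrr sub0r.
Qed.

Lemma hses_surj n : coh_vanishes K n.+1 -> forall x, exists y, hcoh (ses_p E) n y = x.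
Proof.
move=> K0 x; have [f [fZ ->]] := scls_ex x.
have [g gZ gf] := delta_lift fZ (K0 _ (delta_cocycle fZ)).
exists (scls _ gZ); rewrite hcoh_scls; apply/scls_eq.
by rewrite -/(p _) gf subrr; apply: insubm0.
Qed.

Lemma hses_exact n y : hcoh (ses_p E) n y = 0 -> exists x, hcoh (ses_i E) n x = y.
Proof.
have [g [gZ ->]] := scls_ex y; rewrite hcoh_scls => /scls_eq0 pg.
(* [p g] is only a coboundary; subtracting the coboundary of a lift of its primitive makes it 0, so
   that the result comes from [K]. In degree 0 nothing has to be corrected. *)
have [g' [g'Z gg' pg']] : exists g', [/\ cocycle F n g', coboundary F n (g - g') & p g' = 0].
  case: n g gZ pg {y} => [|n] g gZ /= pg.
    by exists g; split=> //; rewrite subrr.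
  have [e pe] := pg; exists (g - cobd (s e)); split.
  - by rewrite /= /is_cocycle dB gZ cobd_cobd subrr.
  - by exists (s e); rewrite subKr.
  - by rewrite pB -dp ps -pe; apply: subrr.
have ir : i (r g') = g' by rewrite -[RHS]split pg' s0 addr0.
have rZ : cocycle K n (r g').
  apply: iI; rewrite -di ir g'Z.
  by apply/esym/funext => t; apply: raddf0.
exists (scls _ rZ); rewrite hcoh_scls; apply/scls_eq.
rewrite -/(i _) ir -opprB -scaleN1r; exact: submZ.
Qed.

End Cohomology.

End SplitSes.

Section HdeltaNatural.
Variables (R : comPzRingType) (G : groupType) (K F A K' F' A' : gmodule R G).
Variables (E : split_ses K F A) (E' : split_ses K' F' A').
Variables (a : ghom K K') (b : ghom F F') (c : ghom A A').
Hypothesis bs : forall x, b (ses_s E x) = ses_s E' (c x).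
Hypothesis ar : forall x, a (ses_r E x) = ses_r E' (b x).

Lemma delta_natural n (f : cochain A n) :
  cochain_map a (delta E f) = delta E' (cochain_map c f).
Proof.
rewrite /delta (_ : post (ses_s E') (cochain_map c f) =
  cochain_map b (post (ses_s E) f : cochain F n)).
  by rewrite -cochain_map_cobd; apply/funext => t; apply: ar.
by apply/funext => t; apply/esym/bs.
Qed.

Lemma hdelta_natural (n : nat) (x : Hcoh A n) :
  hcoh a n.+1 (hdelta E n x) = hdelta E' n (hcoh c n x).
Proof.
have [f [fZ ->]] := scls_ex x.
rewrite hdelta_scls (hcoh_scls a) (hcoh_scls c) hdelta_scls.
by apply/scls_eq; rewrite delta_natural subrr; apply: insubm0.
Qed.

End HdeltaNatural.

(** * Functoriality and connecting maps in homology *)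

Section HomologyMaps.
Variables (R : comPzRingType) (G : groupType).
Implicit Types M N : gmodule R G.

Definition hom_vanishes M n : Prop :=
  forall x : chain M n, cycle M n x -> boundary M n x.

Lemma hom_vanishesP M (n : nat) : hom_vanishes M n <-> forall x : Hhom M n, x = 0.
Proof.
split=> [M0 x|M0 f fZ].
  by have [f [fZ ->]] := scls_ex x; apply/scls_eq0; apply: M0.
exact/(scls_eq0 _ fZ)/M0.
Qed.

Lemma chain_mapE M N (f : ghom M N) n (x : chain M n) : chain_map f x = dmap (gtuple G n) f x.
Proof.
have := @dirsum_linear_ext R (gtuple G n) M (chain N n)
  (mk_linear (@chain_map_linear R G M N f n)) (dmap (gtuple G n) f).
by apply=> t m; rewrite dmap_single; apply: chain_map_single.
Qed.

Definition hhom M N (f : ghom M N) (n : nat) : {linear Hhom M n -> Hhom N n} :=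
  @subquo_lin R _ _ _ (boundary M n) _ (boundary N n) (@chain_map R G M N f n)
    (@chain_map_cycle R G M N f n) (@chain_map_boundary R G M N f n).

Lemma hhomE M N (f : ghom M N) (n : nat) (x : Hhom M n) : Hhom_map f x = hhom f n x.
Proof. by []. Qed.

Lemma hhom_scls M N (f : ghom M N) n (c : chain M n) (cZ : cycle M n c) :
  hhom f n (scls _ cZ) = scls _ (chain_map_cycle f cZ).
Proof. exact: subquo_lin_scls. Qed.

Lemma hom_vanishes_retract M N (i : ghom M N) (p : ghom N M) n :
  (forall a, p (i a) = a) -> hom_vanishes N n -> hom_vanishes M n.
Proof.
move=> pi N0 x xZ; have [y ixy] := N0 _ (chain_map_cycle i xZ).
exists (chain_map p y); rewrite -chain_map_bd -ixy !chain_mapE.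
by rewrite (dmap_comp (h := idfun)) // dmap_id.
Qed.

End HomologyMaps.

Section SplitSesHomology.
Variables (R : comPzRingType) (G : groupType) (K F A : gmodule R G).
Variable E : split_ses K F A.
Implicit Types n : nat.

Definition partial n (x : chain A n.+1) : chain K n :=
  dmap (gtuple G n) (ses_r E) (bd (dmap (gtuple G n.+1) (ses_s E) x : chain F n.+1)).

Fact partial_linear n : linear (@partial n).
Proof. by move=> a x y; rewrite /partial linearP bd_linear linearP. Qed.

Let i n (x : chain K n) : chain F n := dmap (gtuple G n) (ses_i E) x.
Let p n (x : chain F n) : chain A n := dmap (gtuple G n) (ses_p E) x.
Let s n (x : chain A n) : chain F n := dmap (gtuple G n) (ses_s E) x.
Let r n (x : chain F n) : chain K n := dmap (gtuple G n) (ses_r E) x.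

Let ps n (x : chain A n) : p (s x) = x.
Proof. by apply: dirsumP => t; apply: ses_ps. Qed.
Let ri n (x : chain K n) : r (i x) = x.
Proof. by apply: dirsumP => t; apply: ses_ri. Qed.
Let pi n (x : chain K n) : p (i x) = 0.
Proof. by apply: dirsumP => t; apply: ses_pi. Qed.
Let split n (x : chain F n) : i (r x) + s (p x) = x.
Proof. by apply: dirsumP => t; apply: ses_split. Qed.
Let iI n : injective (@i n). Proof. exact: (can_inj (@ri n)). Qed.
Let dp n (x : chain F n.+1) : bd (p x) = p (bd x).
Proof. by rewrite /p -!chain_mapE chain_map_bd. Qed.
Let di n (x : chain K n.+1) : bd (i x) = i (bd x).
Proof. by rewrite /i -!chain_mapE chain_map_bd. Qed.
Let dB (B : gmodule R G) n (x y : chain B n.+1) : bd (x - y) = bd x - bd y.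
Proof. by rewrite -scaleN1r addrC bd_linear scaleN1r addrC. Qed.
Let dN (B : gmodule R G) n (x : chain B n.+1) : bd (- x) = - bd x.
Proof. by rewrite -sub0r dB raddf0 sub0r. Qed.
Let pB n (x y : chain F n) : p (x - y) = p x - p y.
Proof. exact: raddfB. Qed.
Let s0 n : s (0 : chain A n) = 0.
Proof. exact: raddf0. Qed.
Let rB n (x y : chain F n) : r (x - y) = r x - r y.
Proof. exact: raddfB. Qed.

Lemma partial_i n (x : chain A n.+1) : bd x = 0 -> i (partial x) = bd (s x).
Proof. by move=> dx; rewrite -[RHS]split -dp ps dx s0 addr0. Qed.

Lemma partial_cycle n (x : chain A n.+1) : cycle A n.+1 x -> cycle K n (partial x).
Proof.
case: n x => [|n] x //= dx; apply: iI; rewrite -di partial_i // bd_bd.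
exact/esym/raddf0.
Qed.

Lemma partial_boundary n (x : chain A n.+1) : boundary A n.+1 x -> boundary K n (partial x).
Proof.
move=> [e ->]; exists (- r (bd (s e))); rewrite /partial -/(s _) -/(r _).
have -> : s (bd e) = bd (s e) - i (r (bd (s e))).
  by rewrite -[X in X - _]split -dp ps addrAC subrr add0r.
rewrite dB bd_bd di sub0r dN -[in RHS](ri (bd _)).
exact: raddfN.
Qed.

Definition hpartial n : {linear Hhom A n.+1 -> Hhom K n} :=
  @subquo_lin R _ _ _ (boundary A n.+1) _ (boundary K n) (mk_linear (@partial_linear n))
    (@partial_cycle n) (@partial_boundary n).

Lemma hpartial_scls n (x : chain A n.+1) (xZ : cycle A n.+1 x) :
  hpartial n (scls _ xZ) = scls _ (partial_cycle xZ).
Proof. exact: subquo_lin_scls. Qed.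

Lemma hpartial_inj n : hom_vanishes F n.+1 -> injective (hpartial n).
Proof.
move=> F0; apply: linear_inj_of_ker => x; have [f [fZ ->]] := scls_ex x.
rewrite hpartial_scls => /scls_eq0 [e de].
have gZ : cycle F n.+1 (s f - i e) by rewrite /= dB di -de partial_i // subrr.
have [u gu] := F0 _ gZ; apply/scls_eq0; exists (p u).
by rewrite dp -gu pB ps pi subr0.
Qed.

Lemma hpartial_image n y : (exists x, hpartial n x = y) <-> hhom (ses_i E) n y = 0.
Proof.
split=> [[x <-]|].
  have [f [fZ ->]] := scls_ex x; rewrite hpartial_scls hhom_scls; apply/scls_eq0.
  by exists (s f); rewrite -partial_i // chain_mapE.
have [c [cZ ->]] := scls_ex y; rewrite hhom_scls => /scls_eq0 [u].
rewrite chain_mapE -/(i c) => iu.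
have pu : cycle A n.+1 (p u) by rewrite /= dp -iu; apply: pi.
exists (scls _ pu); rewrite hpartial_scls; apply/scls_eq; exists (- r u).
rewrite /partial -/(s _) -/(r _).
have -> : s (p u) = u - i (r u) by rewrite -[X in X - _]split addrAC subrr add0r.
by rewrite dB di -iu rB !ri dN addrAC subrr sub0r.
Qed.

End SplitSesHomology.

Section HpartialNatural.
Variables (R : comPzRingType) (G : groupType) (K F A K' F' A' : gmodule R G).
Variables (E : split_ses K F A) (E' : split_ses K' F' A').
Variables (a : ghom K K') (b : ghom F F') (c : ghom A A').
Hypothesis bs : forall x, b (ses_s E x) = ses_s E' (c x).
Hypothesis ar : forall x, a (ses_r E x) = ses_r E' (b x).

Lemma partial_natural n (x : chain A n.+1) :
  chain_map a (partial E x) = partial E' (chain_map c x).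
Proof.
rewrite /partial (_ : dmap (gtuple G n.+1) (ses_s E') (chain_map c x) =
  chain_map b (dmap (gtuple G n.+1) (ses_s E) x : chain F n.+1)).
  by rewrite -chain_map_bd !chain_mapE; apply: dirsumP => t; apply: ar.
by rewrite !chain_mapE; apply: dirsumP => t; apply/esym/bs.
Qed.

Lemma hpartial_natural n (x : Hhom A n.+1) :
  hhom a n (hpartial E n x) = hpartial E' n (hhom c n.+1 x).
Proof.
have [f [fZ ->]] := scls_ex x.
rewrite hpartial_scls (hhom_scls a) (hhom_scls c) hpartial_scls.
by apply/scls_eq; rewrite partial_natural subrr; apply: insubm0.
Qed.

End HpartialNatural.

(** * Homology of induced modules *)

Section InducedHomology.
Variables (R : comPzRingType) (G : groupType).

Definition gcons n (u : G) (t : gtuple G n) : gtuple G n.+1 :=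
  [ffun j => if unlift ord0 j is Some j' then t j' else u].

Lemma gcons0 n u (t : gtuple G n) : gcons u t ord0 = u.
Proof. by rewrite ffunE unlift_none. Qed.

Lemma gcons_lift n u (t : gtuple G n) j : gcons u t (lift ord0 j) = t j.
Proof. by rewrite ffunE liftK. Qed.

Lemma face0_gcons n u (t : gtuple G n) : face 0 (gcons u t) = t.
Proof. by apply/ffunP => j; rewrite [LHS]ffunE /= gcons_lift. Qed.

Lemma face1_gcons n u (t : gtuple G n.+1) :
  face 1 (gcons u t) = gcons (u * t ord0)%g (face 0 t).
Proof.
apply/ffunP => j; case: (unliftP ord0 j) => [j' ->|->].
  by rewrite [LHS]ffunE !gcons_lift /= [RHS]ffunE.
rewrite [LHS]ffunE !gcons0 /= (_ : widen_ord _ _ = ord0) ?gcons0 ?gcons_lift //.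
exact: val_inj.
Qed.

Lemma faceS_gcons n u (t : gtuple G n.+1) i :
  face i.+2 (gcons u t) = gcons u (face i.+1 t).
Proof.
apply/ffunP => j; case: (unliftP ord0 j) => [j' ->|->].
  rewrite [LHS]ffunE !gcons_lift [RHS]ffunE.
  rewrite (_ : widen_ord _ (lift ord0 j') = lift ord0 (widen_ord (leqnSn n) j')).
    by rewrite gcons_lift.
  exact: val_inj.
by rewrite [LHS]ffunE gcons0 /= (_ : widen_ord _ _ = ord0) ?gcons0 //; apply: val_inj.
Qed.

Lemma bd_bd_single (M : gmodule R G) n (t : gtuple G n.+1) m :
  bd (single t m : chain M n.+1) = bd_single t m.
Proof. by rewrite /bd dext_single //; apply: bd_single_linear. Qed.

Variable N : lmodType R.

(** The contracting homotopy of the bar complex with induced coefficients: the group element in the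
    coefficient becomes a new first coordinate. It is inverted because face 0 acts by the inverse of
    that coordinate. *)
Definition contraction n : {linear chain (ind G N) n -> chain (ind G N) n.+1} :=
  dlin (fun t => dlin (fun g =>
    slin (ind G N) (gcons g^-1%g t) \o slin N (1%g : G) : {linear N -> chain (ind G N) n.+1})).

Lemma contraction_single n t g nu :
  contraction n (single t (single g nu : ind G N)) =
  single (gcons g^-1%g t) (single 1%g nu : ind G N).
Proof. by rewrite /contraction !dlin_single. Qed.

Lemma bd_contraction n (x : chain (ind G N) n.+1) :
  bd (contraction n.+1 x) + contraction n (bd x) = x.
Proof.
pose D : {linear chain (ind G N) n.+1 -> chain (ind G N) n.+1} :=
  (@bd R G (ind G N) n.+1 \o contraction n.+1) \+ (contraction n \o @bd R G (ind G N) n).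
apply: (@dirsum_linear_ext _ _ _ _ D idfun) => t.
apply: (@dirsum_linear_ext _ _ _ _ (D \o slin _ t) (slin _ t)) => g nu.
rewrite -[LHS]/(bd (contraction n.+1 (single t (single g nu : ind G N))) +
  contraction n (bd (single t (single g nu : ind G N)))) -[RHS]/(single t (single g nu : ind G N)).
(* Face 0 of the new simplex restores the chain, face 1 cancels the contraction of face 0, and face
   [i.+2] cancels that of face [i.+1]. *)
rewrite contraction_single !bd_bd_single /bd_single (linearD (contraction n)).
rewrite (linear_sum (contraction n)) face0_gcons gcons0 invgK !ind_act_single mulg1.
rewrite contraction_single big_ord_recl expr1 scaleN1r face1_gcons invgM invgK.
set b := single (gcons (_ * _)%g _) _; rewrite -[RHS]addr0 -!addrA; congr (_ + _).
rewrite [X in _ + X]addrCA addrA addNr add0r -big_split.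
apply: big1 => i _; rewrite (linearZ_LR (contraction n)) contraction_single.
by rewrite lift0 faceS_gcons exprS mulN1r scaleNr; apply: addNr.
Qed.

Lemma ind_hom_vanishes n : hom_vanishes (ind G N) n.+1.
Proof.
move=> x /= dx; exists (contraction n.+1 x).
by rewrite -[LHS]bd_contraction dx raddf0 addr0.
Qed.

End InducedHomology.

Section DiagonalInduced.
Variables (R : comPzRingType).

Fact tens_linear_r (C A : lmodType R) (c : C) : linear (tens c : A -> tensor C A).
Proof. by move=> a u v; rewrite tensDr tensZr. Qed.
Definition tens_r (C A : lmodType R) (c : C) : {linear A -> tensor C A} :=
  mk_linear (@tens_linear_r C A c).

Fact tens_linear_l (C A : lmodType R) (a : A) : linear ((@tens R C A)^~ a).
Proof. by move=> r u v; rewrite tensDl tensZl. Qed.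
Definition tens_l (C A : lmodType R) (a : A) : {linear C -> tensor C A} :=
  mk_linear (@tens_linear_l C A a).

Lemma tens0 (C A : lmodType R) (c : C) : tens c 0 = 0 :> tensor C A.
Proof. exact: (raddf0 (tens_r A c)). Qed.

End DiagonalInduced.

Section Generators.
Variables (R : comPzRingType) (G : groupType).

Definition pt (M : lmodType R) (t : G) : {linear M -> ind G M} := slin M t.

Definition ind_lin (M W : lmodType R) (h : G -> {linear M -> W}) : {linear ind G M -> W} :=
  dlin h.

Lemma ind_lin_pt (M W : lmodType R) (h : G -> {linear M -> W}) t m :
  ind_lin h (pt M t m) = h t m.
Proof. exact: dlin_single. Qed.

Lemma ind_linear_ext (M W : lmodType R) (f g : {linear ind G M -> W}) :
  (forall t m, f (pt M t m) = g (pt M t m)) -> f =1 g.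
Proof. exact: (@dirsum_linear_ext R G M W). Qed.

Lemma act_pt (M : lmodType R) g t m : gact (ind G M) g (pt M t m) = pt M (g * t)%g m.
Proof. exact: ind_act_single. Qed.

Lemma ind_map_pt (M N : lmodType R) (f : {linear M -> N}) t m :
  ind_map G f (pt M t m) = pt N t (f m).
Proof. exact: dmap_single. Qed.

Lemma ind_ext_pt (M : lmodType R) (B : gmodule R G) (f : {linear M -> B}) t m :
  ind_ext f (pt M t m) = gact B t (f m).
Proof. exact: ind_ext_single. Qed.

Variable C : rgmodule R G.

Definition dtens (A : gmodule R G) (c : C) : {linear A -> diag C A} := tens_r A c.

Lemma diag_linear_ext (A : gmodule R G) (W : lmodType R) (f g : {linear diag C A -> W}) :
  (forall c a, f (dtens A c a) = g (dtens A c a)) -> f =1 g.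
Proof. exact: (@tensor_ext R C A W). Qed.

Lemma act_dtens (A : gmodule R G) g c a :
  gact (diag C A) g (dtens A c a) = dtens A (ract C g^-1%g c) (gact A g a).
Proof. exact: tensor_map_tens. Qed.

Lemma diag_map_dtens (A B : gmodule R G) (f : ghom A B) c a :
  diag_map C f (dtens A c a) = dtens B c (f a).
Proof. exact: tensor_map_tens. Qed.

Definition diag_lift (A : gmodule R G) (W : lmodType R) (b : C -> A -> W)
    (bl : forall a, linear (b^~ a)) (br : forall c, linear (b c)) : {linear diag C A -> W} :=
  tensor_lift bl br.

Lemma diag_lift_dtens (A : gmodule R G) (W : lmodType R) (b : C -> A -> W) bl br c a :
  @diag_lift A W b bl br (dtens A c a) = b c a.
Proof. exact: tensor_lift_tens. Qed.

Definition dtmap (M : lmodType R) (A : gmodule R G) (f : {linear C -> C}) (h : {linear M -> A}) :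
  {linear tensor C M -> diag C A} := tensor_map f h.

Lemma dtmap_tens (M : lmodType R) (A : gmodule R G) (f : {linear C -> C})
    (h : {linear M -> A}) c m :
  dtmap f h (tens c m) = dtens A (f c) (h m).
Proof. exact: tensor_map_tens. Qed.

Lemma tensor_linear_ext (M W : lmodType R) (f g : {linear tensor C M -> W}) :
  (forall c m, f (tens c m) = g (tens c m)) -> f =1 g.
Proof. exact: tensor_ext. Qed.

End Generators.

(* [C (x) RG (x) M] with the diagonal action is induced from [C (x) M]. *)
Section Untwist.
Variables (R : comPzRingType) (G : groupType) (C : rgmodule R G) (M : lmodType R).

Section UntwistFun.
Variables (c : C) (f : ind G M).
Fact untwist_fin : finsupp_submodule G (tensor C M)
  (fun g => tens (ract C g c) (dcoef f g)).
Proof.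
apply: sub_finite_set (subm_prop f) => t /=.
by apply: contraNN => /eqP ft; rewrite (ft : dcoef f t = 0) tens0.
Qed.
Definition untwist_fun : ind G (tensor C M) := insubm_sub untwist_fin.
End UntwistFun.

Fact untwist_bl f : linear (untwist_fun^~ f).
Proof.
move=> a c c'; apply: dirsumP => g; rewrite dcoef_linear /dcoef /=.
by rewrite linearP tensDl tensZl.
Qed.
Fact untwist_br c : linear (untwist_fun c).
Proof.
move=> a f f'; apply: dirsumP => g; rewrite dcoef_linear /dcoef /=.
by rewrite -tensZr -tensDr.
Qed.

Definition untwist_lin : {linear diag C (ind G M) -> ind G (tensor C M)} :=
  diag_lift untwist_bl untwist_br.

Lemma untwist_act_fun g c f :
  untwist_fun (ract C g^-1%g c) (gact (ind G M) g f) =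
  gact (ind G (tensor C M)) g (untwist_fun c f).
Proof. by apply: dirsumP => h; rewrite /dcoef /= ractM. Qed.

Fact untwist_act g (x : diag C (ind G M)) :
  untwist_lin (gact (diag C (ind G M)) g x) = gact (ind G (tensor C M)) g (untwist_lin x).
Proof.
pose D1 : {linear diag C (ind G M) -> ind G (tensor C M)} :=
  untwist_lin \o gact (diag C (ind G M)) g.
pose D2 : {linear diag C (ind G M) -> ind G (tensor C M)} :=
  gact (ind G (tensor C M)) g \o untwist_lin.
suff DE : D1 =1 D2 by exact: (DE x).
apply: diag_linear_ext => c f.
rewrite -[LHS]/(untwist_lin (gact (diag C (ind G M)) g (dtens _ c f))).
rewrite -[RHS]/(gact (ind G (tensor C M)) g (untwist_lin (dtens _ c f))) act_dtens !diag_lift_dtens.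
exact: untwist_act_fun.
Qed.
Definition untwist : ghom (diag C (ind G M)) (ind G (tensor C M)) := GHom untwist_act.

Lemma untwist_pt c g m :
  untwist (dtens (ind G M) c (pt M g m)) = pt (tensor C M) g (tens (ract C g c) m).
Proof.
rewrite [LHS]diag_lift_dtens; apply: dirsumP => h; rewrite [LHS]/dcoef [RHS]/dcoef /=.
by rewrite /dcoef /=; case: eqP => [->//|_]; apply: tens0.
Qed.

Definition twist_lin : {linear ind G (tensor C M) -> diag C (ind G M)} :=
  ind_lin (fun g => dtmap (ract C g^-1%g) (pt M g)).

Lemma twist_pt g c m :
  twist_lin (pt _ g (tens c m)) = dtens (ind G M) (ract C g^-1%g c) (pt M g m).
Proof. by rewrite ind_lin_pt dtmap_tens. Qed.

Fact twist_act g (x : ind G (tensor C M)) :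
  twist_lin (gact (ind G (tensor C M)) g x) = gact (diag C (ind G M)) g (twist_lin x).
Proof.
pose D1 : {linear ind G (tensor C M) -> diag C (ind G M)} :=
  twist_lin \o gact (ind G (tensor C M)) g.
pose D2 : {linear ind G (tensor C M) -> diag C (ind G M)} :=
  gact (diag C (ind G M)) g \o twist_lin.
suff DE : D1 =1 D2 by exact: (DE x).
apply: ind_linear_ext => h.
suff DE : D1 \o pt (tensor C M) h =1 D2 \o pt (tensor C M) h by exact: DE.
apply: tensor_linear_ext => c m.
rewrite -[LHS]/(twist_lin (gact (ind G (tensor C M)) g (pt _ h (tens c m)))).
rewrite -[RHS]/(gact (diag C (ind G M)) g (twist_lin (pt _ h (tens c m)))).
by rewrite act_pt !twist_pt act_dtens act_pt invgM ractM.
Qed.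
Definition twist : ghom (ind G (tensor C M)) (diag C (ind G M)) := GHom twist_act.

(** This side of the inverse makes [diag C (ind G M)] a retract of an induced module, whose homology
    vanishes in positive degrees. *)
Lemma untwistK x : twist (untwist x) = x.
Proof.
pose D : {linear diag C (ind G M) -> diag C (ind G M)} := twist_lin \o untwist_lin.
suff DE : D =1 idfun by exact: (DE x).
apply: diag_linear_ext => c.
suff DE : D \o dtens (ind G M) c =1 dtens (ind G M) c by exact: DE.
apply: ind_linear_ext => g m.
rewrite -[LHS]/(twist (untwist (dtens _ c (pt M g m)))).
by rewrite untwist_pt [LHS] twist_pt -ractM mulgV ract1.
Qed.

Lemma diag_ind_hom_vanishes n : hom_vanishes (diag C (ind G M)) n.+1.
Proof. exact: hom_vanishes_retract untwistK (@ind_hom_vanishes _ _ _ n). Qed.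

End Untwist.

(** * The canonical resolution and the dualizing module *)

Section KernelModule.
Variables (R : comPzRingType) (G : groupType) (A B : gmodule R G) (f : ghom A B).

Definition ker_sub : submodule A := preim_submodule f (null_submodule B).

Fact ker_sub_act g (a : subm ker_sub) : ker_sub (gact A g (val a)).
Proof. by rewrite /= ghom_act (subm_prop a : f (val a) = 0) raddf0. Qed.

Definition ker_act g (a : subm ker_sub) : subm ker_sub := insubm_sub (ker_sub_act g a).
Fact ker_act_linear g : linear (ker_act g).
Proof. by move=> r a b; apply: val_inj; apply: (linearP (gact A g)). Qed.
Fact ker_act1 a : mk_linear (ker_act_linear 1%g) a = a.
Proof. by apply: val_inj; apply: gact1. Qed.
Fact ker_actM g h a : mk_linear (ker_act_linear (g * h)%g) a =
  mk_linear (ker_act_linear g) (mk_linear (ker_act_linear h) a).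
Proof. by apply: val_inj; apply: gactM. Qed.
Definition kermod : gmodule R G := GModule ker_act1 ker_actM.

Definition ker_incl : ghom kermod A :=
  @GHom R G kermod A (mk_linear (@subm_val_linear R A ker_sub)) (fun _ _ => erefl).

Lemma ker_inclP (a : kermod) : f (ker_incl a) = 0.
Proof. exact: (subm_prop a). Qed.

Lemma ker_incl_inj : injective ker_incl.
Proof. exact: val_inj. Qed.

Definition ker_mk (a : A) (fa : f a = 0) : kermod := @insubm_sub R A ker_sub a fa.

Lemma ker_mkK a (fa : f a = 0) : ker_incl (ker_mk fa) = a.
Proof. by []. Qed.

End KernelModule.

Section Resolution.
Variables (R : comPzRingType) (G : groupType).

Section Object.
Variable A : gmodule R G.

Definition eps : ghom (ind G A) A := ind_ext (idfun : {linear A -> A}).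

Lemma eps_pt g a : eps (pt A g a) = gact A g a.
Proof. exact: ind_ext_pt. Qed.

Lemma eps_pt1 a : eps (pt A 1%g a) = a.
Proof. by rewrite eps_pt gact1. Qed.

Fact syz_r_proof f : eps (f - pt A 1%g (eps f)) = 0.
Proof. by rewrite (linearB eps) eps_pt1 subrr. Qed.
Definition syz_r (f : ind G A) : kermod eps := ker_mk (syz_r_proof f).
Fact syz_r_linear : linear syz_r.
Proof.
move=> a f g; apply: ker_incl_inj; rewrite linearP !ker_mkK (linearP eps) (linearP (pt A 1%g)).
by rewrite scalerBr addrACA opprD.
Qed.

Fact syz_ri k : mk_linear syz_r_linear (ker_incl eps k) = k.
Proof. by apply: ker_incl_inj; rewrite ker_mkK ker_inclP raddf0 subr0. Qed.
Fact syz_split f : ker_incl eps (mk_linear syz_r_linear f) + pt A 1%g (eps f) = f.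
Proof. by rewrite ker_mkK subrK. Qed.

Definition ind_ses : split_ses (kermod eps) (ind G A) A :=
  SplitSes eps_pt1 syz_ri syz_split.
End Object.

Section Morphism.
Variables (A B : gmodule R G) (f : ghom A B).

Lemma eps_natural x : eps B (ind_map G f x) = f (eps A x).
Proof.
pose D1 : {linear ind G A -> B} := eps B \o ind_map G f.
pose D2 : {linear ind G A -> B} := f \o eps A.
suff DE : D1 =1 D2 by exact: (DE x).
apply: ind_linear_ext => t a.
rewrite -[LHS]/(eps B (ind_map G f (pt A t a))) -[RHS]/(f (eps A (pt A t a))).
by rewrite ind_map_pt !eps_pt ghom_act.
Qed.

Fact syz_map_proof (k : kermod (eps A)) : eps B (ind_map G f (ker_incl (eps A) k)) = 0.
Proof. by rewrite eps_natural ker_inclP raddf0. Qed.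
Definition syz_map_fun (k : kermod (eps A)) : kermod (eps B) := ker_mk (syz_map_proof k).
Fact syz_map_linear : linear syz_map_fun.
Proof. by move=> a k l; apply: ker_incl_inj; rewrite linearP !ker_mkK !linearP. Qed.
Fact syz_map_act g k :
  mk_linear syz_map_linear (gact _ g k) = gact _ g (mk_linear syz_map_linear k).
Proof. by apply: ker_incl_inj; rewrite ghom_act !ker_mkK !ghom_act. Qed.
Definition syz_map : ghom (kermod (eps A)) (kermod (eps B)) := GHom syz_map_act.

Lemma ind_ses_s a : ind_map G f (ses_s (ind_ses A) a) = ses_s (ind_ses B) (f a).
Proof. exact: ind_map_pt. Qed.

Lemma ind_ses_r x : syz_map (ses_r (ind_ses A) x) = ses_r (ind_ses B) (ind_map G f x).
Proof.
apply: ker_incl_inj; rewrite ker_mkK.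
rewrite -[RHS]/(ind_map G f x - pt B 1%g (eps B (ind_map G f x))) eps_natural.
rewrite -[LHS]/(ind_map G f (x - pt A 1%g (eps A x))) (linearB (ind_map G f)).
by congr (_ - _); apply: ind_map_pt.
Qed.

End Morphism.
End Resolution.

Section DiagonalSes.
Variables (R : comPzRingType) (G : groupType) (C : rgmodule R G).

Definition diag_lin (A B : gmodule R G) (f : {linear A -> B}) : {linear diag C A -> diag C B} :=
  tensor_map (@idfun C) f.

Lemma diag_lin_dtens (A B : gmodule R G) (f : {linear A -> B}) c a :
  diag_lin f (dtens A c a) = dtens B c (f a).
Proof. exact: tensor_map_tens. Qed.

Lemma diag_mapE (A B : gmodule R G) (f : ghom A B) x : diag_map C f x = diag_lin f x.
Proof. by []. Qed.

Lemma diag_lin_comp (A B D : gmodule R G) (f : {linear B -> D}) (g : {linear A -> B})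
    (h : {linear A -> D}) : (forall a, f (g a) = h a) ->
  forall x, diag_lin f (diag_lin g x) = diag_lin h x.
Proof.
move=> fgh x; suff DE : diag_lin f \o diag_lin g =1 diag_lin h by exact: DE.
apply: diag_linear_ext => c a.
by rewrite -[LHS]/(diag_lin f (diag_lin g (dtens A c a))) !diag_lin_dtens fgh.
Qed.

Lemma diag_lin_id (A : gmodule R G) (f : {linear A -> A}) :
  (forall a, f a = a) -> forall x, diag_lin f x = x.
Proof.
move=> fid x; suff DE : diag_lin f =1 idfun by exact: DE.
by apply: diag_linear_ext => c a; rewrite diag_lin_dtens fid.
Qed.

Section Ses.
Variables (K F A : gmodule R G) (E : split_ses K F A).

Fact diag_ps x : diag_map C (ses_p E) (diag_lin (ses_s E) x) = x.
Proof. by rewrite diag_mapE (diag_lin_comp (h := idfun)) ?diag_lin_id //; apply: ses_ps. Qed.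
Fact diag_ri x : diag_lin (ses_r E) (diag_map C (ses_i E) x) = x.
Proof. by rewrite diag_mapE (diag_lin_comp (h := idfun)) ?diag_lin_id //; apply: ses_ri. Qed.
Fact diag_split x : diag_map C (ses_i E) (diag_lin (ses_r E) x) +
  diag_lin (ses_s E) (diag_map C (ses_p E) x) = x.
Proof.
pose D : {linear diag C F -> diag C F} :=
  (diag_map C (ses_i E) \o diag_lin (ses_r E)) \+ (diag_lin (ses_s E) \o diag_map C (ses_p E)).
suff DE : D =1 idfun by exact: (DE x).
apply: diag_linear_ext => c a.
rewrite -[LHS]/(diag_map C (ses_i E) (diag_lin (ses_r E) (dtens F c a)) +
  diag_lin (ses_s E) (diag_map C (ses_p E) (dtens F c a))).
by rewrite !(diag_map_dtens, diag_lin_dtens) -raddfD ses_split.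
Qed.

Definition diag_ses : split_ses (diag C K) (diag C F) (diag C A) :=
  SplitSes diag_ps diag_ri diag_split.
End Ses.
End DiagonalSes.

Lemma hcoh_addP (R : comPzRingType) (G : groupType) (A B : gmodule R G)
    (f g h : ghom A B) a (n : nat) :
  (forall x, h x = a *: f x + g x) ->
  forall y, hcoh h n y = a *: hcoh f n y + hcoh g n y.
Proof.
move=> hfg y; have [c [cZ ->]] := scls_ex y; rewrite !hcoh_scls.
have E : cochain_map h c = a *: cochain_map f c + cochain_map g c by apply/funext => t; apply: hfg.
rewrite -(scls_linear _ _ _ (insubmP a (cochain_map_cocycle f cZ) (cochain_map_cocycle g cZ))).
by apply/scls_eq; rewrite E subrr; apply: insubm0.
Qed.

Section Scalar.
Variables (R : comPzRingType) (M : lmodType R).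
Fact scal_linear (m : M) : linear (fun r : R^o => r *: m).
Proof. by move=> a r s; rewrite scalerDl scalerA. Qed.
Definition scal (m : M) : {linear R^o -> M} := mk_linear (scal_linear m).
Lemma scalE m r : scal m r = r *: m. Proof. by []. Qed.
End Scalar.

Section DualModule.
Variables (R : comPzRingType) (G : groupType) (n : nat).

Definition rtrans (M : lmodType R) (h : G) : ghom (ind G M) (ind G M) := ind_ext (pt M h).

Lemma rtrans_pt (M : lmodType R) h t m : rtrans M h (pt M t m) = pt M (t * h)%g m.
Proof. by rewrite ind_ext_pt act_pt. Qed.

Lemma eq_ind_ghom (M : lmodType R) (B : gmodule R G) (f f' : ghom (ind G M) B) :
  (forall t m, f (pt M t m) = f' (pt M t m)) -> f =1 f'.
Proof. exact: (@ind_linear_ext R G M B). Qed.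

Definition ghom_comp (A B D : gmodule R G) (f : ghom B D) (g : ghom A B) : ghom A D :=
  @GHom R G A D (f \o g) (fun h a => etrans (congr1 f (ghom_act g h a)) (ghom_act f h (g a))).

Lemma hcoh_ghom_comp (A B D : gmodule R G) (f : ghom B D) (g : ghom A B) (x : Hcoh A n) :
  hcoh f n (hcoh g n x) = hcoh (ghom_comp f g) n x.
Proof. exact: hcoh_comp. Qed.

Let D : lmodType R := Hcoh (ind G R^o) n.

Fact dual_act1 (d : D) : hcoh (rtrans R^o 1%g) n d = d.
Proof.
pose ghom_id := @GHom R G (ind G R^o) (ind G R^o) idfun (fun _ _ => erefl).
apply: (hcoh_id (f := rtrans R^o 1%g)).
by apply: (@eq_ind_ghom _ _ _ ghom_id) => t m; rewrite rtrans_pt mulg1.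
Qed.

Fact dual_actM g h (d : D) :
  hcoh (rtrans R^o (g * h)%g) n d = hcoh (rtrans R^o h) n (hcoh (rtrans R^o g) n d).
Proof.
rewrite hcoh_ghom_comp; apply: eq_hcoh; apply: eq_ind_ghom => t m.
by rewrite -[RHS]/(rtrans R^o h (rtrans R^o g (pt R^o t m))) !rtrans_pt mulgA.
Qed.

(* The dualizing module [H^n(G, RG)], with the right action of [G] that comes from
   the right multiplication of [RG]. *)
Definition dual : rgmodule R G := RGModule dual_act1 dual_actM.

Definition evalm (A : gmodule R G) (a : A) : ghom (ind G R^o) A := ind_ext (scal a).

Lemma evalm_pt (A : gmodule R G) (a : A) t r : evalm a (pt R^o t r) = r *: gact A t a.
Proof. by rewrite ind_ext_pt scalE linearZ_LR. Qed.

Fact evalm_linear (A : gmodule R G) (d : dual) : linear (fun a : A => hcoh (evalm a) n d).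
Proof.
move=> r a b; apply: hcoh_addP.
pose L : {linear ind G R^o -> A} := r \*: evalm a \+ evalm b.
suff DE : evalm (r *: a + b) =1 L by exact: DE.
apply: ind_linear_ext => t s.
rewrite -[RHS]/(r *: evalm a (pt R^o t s) + evalm b (pt R^o t s)) !evalm_pt.
by rewrite linearP scalerDr !scalerA mulrC.
Qed.

Fact evalm_linear_l (A : gmodule R G) (a : A) : linear (fun d : dual => hcoh (evalm a) n d).
Proof. by move=> r d d'; rewrite linearP. Qed.

(* [d (x) a] is sent to the image of [d] under the map [RG -> A] with value [a] at 1. *)
Definition dual_ev (A : gmodule R G) : {linear diag dual A -> Hcoh A n} :=
  diag_lift (@evalm_linear_l A) (@evalm_linear A).

Lemma dual_ev_dtens (A : gmodule R G) d a : dual_ev A (dtens A d a) = hcoh (evalm a) n d.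
Proof. exact: diag_lift_dtens. Qed.

Lemma dual_ev_natural (A B : gmodule R G) (f : ghom A B) x :
  dual_ev B (diag_map dual f x) = hcoh f n (dual_ev A x).
Proof.
suff DE : dual_ev B \o diag_map dual f =1 hcoh f n \o dual_ev A by exact: DE.
apply: diag_linear_ext => d a.
rewrite -[LHS]/(dual_ev B (diag_map dual f (dtens A d a))).
rewrite -[RHS]/(hcoh f n (dual_ev A (dtens A d a))).
rewrite diag_map_dtens !dual_ev_dtens hcoh_ghom_comp; apply: eq_hcoh; apply: eq_ind_ghom => t r.
rewrite -[RHS]/(f (evalm a (pt R^o t r))) !evalm_pt.
by rewrite linearZ_LR ghom_act.
Qed.

Lemma dual_ev_inv (A : gmodule R G) g x : dual_ev A (gact (diag dual A) g x) = dual_ev A x.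
Proof.
suff DE : dual_ev A \o gact (diag dual A) g =1 dual_ev A by exact: DE.
apply: diag_linear_ext => d a.
rewrite -[LHS]/(dual_ev A (gact (diag dual A) g (dtens A d a))) act_dtens !dual_ev_dtens.
rewrite -[X in hcoh _ n X]/(hcoh (rtrans R^o g^-1%g) n d) hcoh_ghom_comp.
apply: eq_hcoh; apply: eq_ind_ghom => t r.
rewrite -[LHS]/(evalm (gact A g a) (rtrans R^o g^-1%g (pt R^o t r))) rtrans_pt !evalm_pt.
by rewrite -gactM mulgVK.
Qed.

Fact dual_mu_linear_r (M : lmodType R) (d : dual) :
  linear (fun m : M => hcoh (ind_map G (scal m)) n d).
Proof.
move=> r a b; apply: hcoh_addP.
pose L : {linear ind G R^o -> ind G M} := r \*: ind_map G (scal a) \+ ind_map G (scal b).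
suff DE : ind_map G (scal (r *: a + b)) =1 L by exact: DE.
apply: ind_linear_ext => t s.
rewrite -[RHS]/(r *: ind_map G (scal a) (pt R^o t s) + ind_map G (scal b) (pt R^o t s)) !ind_map_pt.
by rewrite -linearP !scalE scalerDr !scalerA mulrC.
Qed.

Fact dual_mu_linear_l (M : lmodType R) (m : M) :
  linear (fun d : dual => hcoh (ind_map G (scal m)) n d).
Proof. by move=> r d d'; rewrite linearP. Qed.

(** The comparison of H^n(G, RG) (x) M with H^n(G, RG M). Its bijectivity for all M is the
    finiteness property that passes from G to H. *)
Definition dual_mu (M : lmodType R) : {linear tensor dual M -> Hcoh (ind G M) n} :=
  tensor_lift (@dual_mu_linear_l M) (@dual_mu_linear_r M).

Lemma dual_mu_tens (M : lmodType R) d m : dual_mu M (tens d m) = hcoh (ind_map G (scal m)) n d.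
Proof. exact: tensor_lift_tens. Qed.

Lemma eps_mu (A : gmodule R G) (x : diag dual A) : hcoh (eps A) n (dual_mu A x) = dual_ev A x.
Proof.
suff DE : hcoh (eps A) n \o dual_mu A =1 dual_ev A by exact: DE.
apply: tensor_linear_ext => d a.
rewrite -[LHS]/(hcoh (eps A) n (dual_mu A (tens d a))) dual_mu_tens.
rewrite [RHS]dual_ev_dtens hcoh_ghom_comp; apply: eq_hcoh; apply: eq_ind_ghom => t r.
rewrite -[LHS]/(eps A (ind_map G (scal a) (pt R^o t r))) ind_map_pt eps_pt evalm_pt.
by rewrite scalE linearZ_LR.
Qed.

(** For f the sum of the g a_g, this is the sum of the d g (x) a_g: a preimage under [dual_mu] of
    the image of d under the map RG -> RG A with 1 |-> f. It writes the relations that come from the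
    syzygy as tensors. *)
Definition dual_nu (A : gmodule R G) (d : dual) : {linear ind G A -> diag dual A} :=
  ind_lin (fun g => dtens A (ract dual g d)).

Lemma mu_nu (A : gmodule R G) d (f : ind G A) :
  dual_mu A (dual_nu A d f) = hcoh (evalm f) n d.
Proof.
suff DE : dual_mu A \o dual_nu A d =1 mk_linear (@evalm_linear (ind G A) d) by exact: DE.
apply: ind_linear_ext => g a.
rewrite -[LHS]/(dual_mu A (dual_nu A d (pt A g a))) ind_lin_pt [LHS]dual_mu_tens.
rewrite -[RHS]/(hcoh (evalm (pt A g a)) n d).
rewrite -[X in hcoh _ n X]/(hcoh (rtrans R^o g) n d) hcoh_ghom_comp.
apply: eq_hcoh; apply: eq_ind_ghom => t r.
rewrite -[LHS]/(ind_map G (scal a) (rtrans R^o g (pt R^o t r))) rtrans_pt ind_map_pt evalm_pt.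
by rewrite act_pt -linearZ_LR scalE.
Qed.

End DualModule.

(** * The duality criterion *)

Section Coinvariants.
Variables (R : comPzRingType) (G : groupType).

Definition gtuple0 : gtuple G 0 := [ffun i => 1%g].

Lemma gtuple0E (t : gtuple G 0) : t = gtuple0.
Proof. by apply/ffunP => -[]. Qed.

Section Object.
Variable M : gmodule R G.

Definition h0_fun (m : M) : Hhom M 0%N :=
  @scls R (chain M 0) (cycle M 0) (boundary M 0) (single gtuple0 m) I.
Fact h0_linear : linear h0_fun.
Proof.
move=> a m m'; rewrite /h0_fun.
rewrite -(scls_linear _ _ _ (I : cycle M 0 (a *: single gtuple0 m + single gtuple0 m'))).
by apply/scls_eq; rewrite -single_linear subrr; apply: insubm0.
Qed.
Definition h0 : {linear M -> Hhom M 0%N} := mk_linear h0_linear.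

Lemma h0_surj y : exists m, h0 m = y.
Proof.
have [x [xZ ->]] := scls_ex y; exists (dcoef x gtuple0); apply/scls_eq.
rewrite (_ : single _ _ = x) ?subrr; first exact: insubm0.
by apply: dirsumP => t; rewrite [t]gtuple0E /dcoef /= eqxx.
Qed.

Lemma bd_single0 (t : gtuple G 1) m :
  bd_single t m = single gtuple0 (gact M (t ord0)^-1%g m - m) :> chain M 0.
Proof.
rewrite /bd_single big_ord_recl big_ord0 addr0 expr1 scaleN1r !(gtuple0E (face _ _)).
exact/esym/(linearB (slin M gtuple0)).
Qed.

Lemma h0_act g m : h0 (gact M g m) = h0 m.
Proof.
apply/scls_eq; exists (single [ffun=> g^-1%g] m).
rewrite bd_bd_single bd_single0 ffunE invgK.
exact/esym/(linearB (slin M gtuple0)).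
Qed.

(** An invariant map factors through the coinvariants, because it kills the boundary of every
    1-chain. *)
Lemma h0_invariant (W : lmodType R) (Q : {linear M -> W}) m :
  (forall g m, Q (gact M g m) = Q m) -> h0 m = 0 -> Q m = 0.
Proof.
move=> Qg /scls_eq0[y my].
pose Q0 : {linear chain M 0 -> W} := dlin (fun=> Q).
have Qbd : Q0 \o @bd R G M 0 =1 \0.
  apply: dirsum_linear_ext => t m'.
  by rewrite -[LHS]/(Q0 (bd (single t m'))) bd_bd_single bd_single0 dlin_single linearB Qg subrr.
by rewrite -(dlin_single (fun=> Q) gtuple0) my; apply: Qbd.
Qed.
End Object.

Lemma h0_natural (M N : gmodule R G) (f : ghom M N) m : hhom f 0 (h0 M m) = h0 N (f m).
Proof.
rewrite [LHS]hhom_scls; apply/scls_eq; rewrite chain_map_single subrr.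
exact: insubm0.
Qed.

End Coinvariants.

(** One clause of [natural_duality] with the two degrees decoupled, so that the dimension shift
    becomes a step from [k.+1], [j] to [k], [j.+1]. *)
Definition nat_iso (R : comPzRingType) (G : groupType) (C : rgmodule R G) (k j : int) : Prop :=
  exists phi : forall A : gmodule R G, {linear Hcoh A k -> Hhom (diag C A) j},
    (forall A, bijective (phi A)) /\
    (forall (A B : gmodule R G) (f : ghom A B) (x : Hcoh A k),
       phi B (Hcoh_map f x) = Hhom_map (diag_map C f) (phi A x)).

Section TopDegree.
Variables (R : comPzRingType) (G : groupType) (n : nat).
Hypothesis top : forall A : gmodule R G, coh_vanishes A n.+1.
Hypothesis mu_bij : forall M : lmodType R, bijective (dual_mu G n M).
Let D := dual R G n.

(** As H^(n+1) of the syzygy is 0, the map from H^n(G, RG A) is onto, and [dual_mu] identifies its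
    source with D (x) A. *)
Lemma dual_ev_surj (A : gmodule R G) y : exists x, dual_ev n A x = y.
Proof.
have [z <-] := @hses_surj _ _ _ _ _ (ind_ses A) n (@top _) y.
have [g _ gK] := mu_bij A.
by exists (g z); rewrite -eps_mu gK.
Qed.

(* Both [H^n(G, A)] and [H_0(G, D (x) A)] are quotients of [D (x) A], and the relations
   of the former come from [D (x) K] with [K] the kernel of [RG (x) A -> A]. *)
Lemma dual_ev_ker (A : gmodule R G) x : dual_ev n A x = 0 -> h0 (diag D A) x = 0.
Proof.
rewrite -eps_mu => /(@hses_exact _ _ _ _ _ (ind_ses A))[y ixy].
have [z zy] := dual_ev_surj y.
pose I z := hcoh (ker_incl (eps A)) n (dual_ev n (kermod (eps A)) z).
(* [S] holds of the elements of D (x) K whose image in H^n(G, RG A) lifts to a tensor with zero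
   class in H_0. It is a submodule, so pure tensors suffice. *)
pose S z := exists2 x', I z = dual_mu G n A x' & h0 (diag D A) x' = 0.
have IP a u v : I (a *: u + v) = a *: I u + I v by rewrite /I !linearP.
have S0 : S 0.
  exists 0; last exact: (linear0 (h0 (diag D A))).
  by rewrite /I (linear0 (dual_ev n _)) (linear0 (hcoh _ n)) (linear0 (dual_mu G n A)).
have SP a u v : S u -> S v -> S (a *: u + v).
  move=> [u' Iu u'0] [v' Iv v'0]; exists (a *: u' + v').
    by rewrite IP Iu Iv -linearP.
  by rewrite linearP u'0 v'0 scaler0 addr0.
have [x' Ix' x'0] : S z.
  apply: (@tensor_gen _ _ _ (@Submodule _ (diag D (kermod (eps A))) S S0 SP)) => d k.
  rewrite /= -/(dtens (kermod (eps A)) d k).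
  exists (dual_nu A d (ker_incl (eps A) k)).
    rewrite mu_nu /I dual_ev_dtens hcoh_ghom_comp; apply: eq_hcoh.
    apply: eq_ind_ghom => t r.
    rewrite -[LHS]/(ker_incl (eps A) (evalm k (pt R^o t r))) !evalm_pt.
    by rewrite linearZ_LR ghom_act.
  (* In the coinvariants d g (x) a equals d (x) g a, so the lift becomes the class of d (x) [eps] of
     an element of the kernel, which is 0. *)
  have E : h0 (diag D A) \o dual_nu A d =1 h0 (diag D A) \o dtens A d \o eps A.
    apply: ind_linear_ext => g a.
    rewrite -[LHS]/(h0 (diag D A) (dual_nu A d (pt A g a))) ind_lin_pt.
    rewrite -[RHS]/(h0 (diag D A) (dtens A d (eps A (pt A g a)))) eps_pt.
    by rewrite -(h0_act g) act_dtens -ractM mulgV ract1.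
  have Ek : h0 (diag D A) (dual_nu A d (ker_incl (eps A) k)) =
      h0 (diag D A) (dtens A d (eps A (ker_incl (eps A) k))) by exact: E.
  rewrite Ek ker_inclP (linear0 (dtens A d)); exact: (linear0 (h0 (diag D A))).
suff -> : x = x' by [].
apply: (bij_inj (mu_bij A)); rewrite -Ix' -ixy -zy.
by [].
Qed.

Lemma nat_iso_top : nat_iso D n 0%N.
Proof.
have ex (A : gmodule R G) : exists f : {linear Hcoh A n -> Hhom (diag D A) 0%N},
    bijective f /\ (forall x, f (dual_ev n A x) = h0 (diag D A) x).
  apply: factor_surj (@dual_ev_surj A) (@h0_surj _ _ (diag D A)) _ => x.
  split; first exact: dual_ev_ker.
  apply: h0_invariant; exact: dual_ev_inv.
exists (fun A => sval (cid (ex A))); split=> [A|A B f x].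
  by case: (svalP (cid (ex A))).
have [_ pA] := svalP (cid (ex A)); have [_ pB] := svalP (cid (ex B)).
have [y <-] := dual_ev_surj x.
rewrite pA hcohE hhomE -dual_ev_natural pB.
exact/esym/h0_natural.
Qed.

End TopDegree.

Section DimensionShift.
Variables (R : comPzRingType) (G : groupType) (C : rgmodule R G).

(** Both sides inject by connecting maps into those of the syzygy K, with image the kernel of the
    map to the coefficients RG A; naturality of the given isomorphism for K -> RG A matches the two
    kernels. *)
Lemma nat_iso_shift (k j : nat) : (forall M : lmodType R, coh_vanishes (ind G M) k) ->
  nat_iso C k.+1 j -> nat_iso C k j.+1.
Proof.
move=> ind0 [phi [phiB phiN]].
pose K A := kermod (@eps R G A).
pose dA A : {linear Hcoh A k -> Hcoh (K A) k.+1} := hdelta (ind_ses A) k.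
pose pA A : {linear Hhom (diag C A) j.+1 -> Hhom (diag C (K A)) j} :=
  hpartial (diag_ses C (ind_ses A)) j.
have dI A : injective (dA A) by apply: hdelta_inj; apply: ind0.
have pI A : injective (pA A) by apply: hpartial_inj; apply: diag_ind_hom_vanishes.
have ex (A : gmodule R G) : exists f : {linear Hcoh A k -> Hhom (diag C A) j.+1},
    bijective f /\ (forall x, pA A (f x) = phi (K A) (dA A x)).
  apply: (factor_inj (i := phi (K A) \o dA A) (j := pA A)) => [|//|w].
    by apply: inj_comp (@dI A); apply: bij_inj.
  have [psi phiK psiK] := phiB (K A).
  rewrite (hpartial_image (diag_ses C (ind_ses A))) -[w]psiK.
  rewrite -[X in _ <-> X = 0]/(Hhom_map (diag_map C (ker_incl (eps A))) (phi (K A) (psi w))).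
  rewrite -phiN hcohE.
  split=> [[x /(bij_inj (phiB (K A))) dx]|iw].
    suff -> : hcoh (ker_incl (eps A)) k.+1 (psi w) = 0 by apply: raddf0.
    by apply/(hdelta_image (ind_ses A)); exists x.
  have /(hdelta_image (ind_ses A))[x dx] : hcoh (ker_incl (eps A)) k.+1 (psi w) = 0.
    by apply: (bij_inj (phiB (ind G A))); rewrite raddf0.
  by exists x; apply: (congr1 (phi (K A)) dx).
exists (fun A => sval (cid (ex A))); split=> [A|A B f x].
  by case: (svalP (cid (ex A))).
have [_ fA] := svalP (cid (ex A)); have [_ fB] := svalP (cid (ex B)).
apply: pI; rewrite fB hcohE hhomE.
rewrite -[LHS]/(phi (K B) (hdelta (ind_ses B) k (hcoh f k x))).
rewrite -(hdelta_natural (E := ind_ses A) (a := syz_map f) (b := ind_map G f)); first last.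
- exact: ind_ses_r.
- exact: ind_ses_s.
rewrite -hcohE phiN hhomE -[phi _ _]fA.
apply: (@hpartial_natural _ _ _ _ _ _ _ _ (diag_ses C (ind_ses A)) (diag_ses C (ind_ses B)) _
  (diag_map C (ind_map G f)) (diag_map C f)) => y.
- transitivity (diag_lin C (ses_s (ind_ses B) \o f) y).
    by apply: diag_lin_comp => a; apply: ind_ses_s.
  by apply/esym; apply: diag_lin_comp.
- transitivity (diag_lin C (ses_r (ind_ses B) \o ind_map G f) y).
    by apply: diag_lin_comp => a; apply: ind_ses_r.
  by apply/esym; apply: diag_lin_comp.
Qed.

Lemma hom_vanishes_shift (j : nat) :
  (forall A : gmodule R G, hom_vanishes (diag C A) j) ->
  forall A : gmodule R G, hom_vanishes (diag C A) j.+1.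
Proof.
move=> H0 A; apply/hom_vanishesP => x.
apply: (hpartial_inj (E := diag_ses C (ind_ses A)) (@diag_ind_hom_vanishes _ _ C A j)).
have /hom_vanishesP KH0 := H0 (kermod (eps A)).
by rewrite raddf0; apply: KH0.
Qed.

(** The image of H_(j+1)(C (x) A) in H_j(C (x) K) dies in H_j(C (x) RG A). Under the isomorphism in
    degree 0 that map is H^0(K) -> H^0(RG A), which is injective because 0-coboundaries are 0. *)
Lemma hom_vanishes_above (j : nat) : nat_iso C 0%N j ->
  forall A : gmodule R G, hom_vanishes (diag C A) j.+1.
Proof.
move=> [phi [phiB phiN]] A; apply/hom_vanishesP => x.
pose K := kermod (eps A).
apply: (hpartial_inj (E := diag_ses C (ind_ses A)) (@diag_ind_hom_vanishes _ _ C A j)).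
rewrite raddf0; set w := hpartial _ _ _.
have iw : Hhom_map (diag_map C (ker_incl (eps A))) w = 0.
  by rewrite hhomE; apply/(hpartial_image (diag_ses C (ind_ses A))); exists x.
have [psi phiK psiK] := phiB K.
move: iw; rewrite -[w]psiK -phiN => iw.
have {iw} : hcoh (ker_incl (eps A)) 0 (psi w) = 0.
  by apply: (bij_inj (phiB (ind G A))); rewrite (linear0 (phi (ind G A))).
have [c [cZ psic]] := scls_ex (psi w); rewrite psic hcoh_scls => /scls_eq0 /= ic0.
suff p0 : psi w = 0 by rewrite -psic p0 (linear0 (phi K)).
rewrite psic; apply/(scls_eq0 (coboundary K 0) cZ); apply/funext => t.
apply: (@ker_incl_inj _ _ _ _ (eps A)).
rewrite -[LHS]/(cochain_map (ker_incl (eps A)) c t) ic0.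
exact/esym/raddf0.
Qed.

Lemma nat_iso_zero (k j : int) : (forall (A : gmodule R G) (x : Hcoh A k), x = 0) ->
  (forall (A : gmodule R G) (y : Hhom (diag C A) j), y = 0) -> nat_iso C k j.
Proof.
move=> H0 H0'; exists (fun A => \0); split=> [A|A B f x].
  by exists (fun=> 0) => x; [rewrite [RHS](H0 A)|rewrite [RHS](H0' A)].
by rewrite [LHS](H0' B) [RHS](H0' B).
Qed.

End DimensionShift.

(* Bieri's criterion, with the finiteness condition on [G] replaced by the bijectivity
   of [H^n(G, RG) (x) M -> H^n(G, RG (x) M)]. *)
Lemma dual_natural_duality (R : comPzRingType) (G : groupType) (n : nat) :
  (forall k (A : gmodule R G), (n < k)%N -> coh_vanishes A k) ->
  (forall k (M : lmodType R), (k < n)%N -> coh_vanishes (ind G M) k) ->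
  (forall M : lmodType R, bijective (dual_mu G n M)) ->
  natural_duality (dual R G n) n.
Proof.
move=> above below mu.
have iso j : (j <= n)%N -> nat_iso (dual R G n) (n - j)%N j.
  elim: j => [|j IH] jn.
    by rewrite subn0; apply: nat_iso_top => // A; apply: above.
  apply: nat_iso_shift; first by move=> M; apply: below; lia.
  by rewrite -subSn // subSS; apply: IH; lia.
have high j A : (n < j)%N -> hom_vanishes (diag (dual R G n) A) j.
  elim: j A => // j IH A; rewrite ltnS leq_eqVlt => /orP[/eqP nj|/IH IHj].
    by apply: hom_vanishes_above; rewrite -nj -[X in nat_iso _ (Posz X)](subnn n); apply: iso.
  by apply: hom_vanishes_shift => B; apply: IHj.
suff main k : nat_iso (dual R G n) k (n%:Z - k) by exact: main.
case: k => [k|m].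
  have [kn|nk] := leqP k n.
    have -> : n%:Z - k%:Z = (n - k)%N by lia.
    by rewrite -[X in nat_iso _ (Posz X)](subKn kn); apply: iso; lia.
  (* [Negz m] is -(m + 1), whence the predecessor. *)
  have -> : n%:Z - k%:Z = Negz (k - n).-1 by lia.
  apply: nat_iso_zero => [A x|A y]; first by move: x; apply/coh_vanishesP; apply: above.
  exact: thinmx0.
have -> : n%:Z - Negz m = (n + m.+1)%N by lia.
apply: nat_iso_zero => [A x|A y]; first exact: thinmx0.
by move: y; apply/hom_vanishesP; apply: high; lia.
Qed.

(** * Coarse invariance *)

Section TopInduced.
Variables (R : comPzRingType) (G : groupType) (C : rgmodule R G).

Section Object.
Variable M : lmodType R.

(** Sends c (x) g m to c g (x) m. It is invariant under the diagonal action and induces the inverse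
    of [top_ind], so that C (x) M is the module of coinvariants of C (x) RG M. *)
Definition collapse : {linear diag C (ind G M) -> tensor C M} :=
  ind_lin (fun=> idfun) \o untwist C M.

Lemma collapse_pt c g m : collapse (dtens (ind G M) c (pt M g m)) = tens (ract C g c) m.
Proof.
rewrite -[LHS]/(ind_lin (fun=> idfun) (untwist C M (dtens (ind G M) c (pt M g m)))).
by rewrite untwist_pt ind_lin_pt.
Qed.

Definition top_ind : {linear tensor C M -> Hhom (diag C (ind G M)) 0%N} :=
  h0 (diag C (ind G M)) \o dtmap idfun (pt M 1%g).

Lemma top_ind_tens c m : top_ind (tens c m) = h0 _ (dtens (ind G M) c (pt M 1%g m)).
Proof. by rewrite -(dtmap_tens (A := ind G M) idfun). Qed.

Lemma collapse_act g x : collapse (gact (diag C (ind G M)) g x) = collapse x.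
Proof.
suff DE : collapse \o gact (diag C (ind G M)) g =1 collapse by exact: DE.
apply: diag_linear_ext => c.
suff DE : (collapse \o gact (diag C (ind G M)) g) \o dtens (ind G M) c =1
  collapse \o dtens (ind G M) c by exact: DE.
apply: ind_linear_ext => h m.
rewrite -[LHS]/(collapse (gact _ g (dtens (ind G M) c (pt M h m)))).
rewrite -[RHS]/(collapse (dtens (ind G M) c (pt M h m))) act_dtens act_pt !collapse_pt.
by rewrite -ractM mulKg.
Qed.

Lemma top_ind_collapse x : top_ind (collapse x) = h0 _ x.
Proof.
suff DE : top_ind \o collapse =1 h0 (diag C (ind G M)) by exact: DE.
apply: diag_linear_ext => c.
suff DE : (top_ind \o collapse) \o dtens (ind G M) c =1
  h0 (diag C (ind G M)) \o dtens (ind G M) c by exact: DE.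
apply: ind_linear_ext => g m.
rewrite -[LHS]/(top_ind (collapse (dtens (ind G M) c (pt M g m)))) collapse_pt top_ind_tens.
rewrite -[RHS]/(h0 _ (dtens (ind G M) c (pt M g m))) -[RHS](h0_act g^-1%g).
by rewrite act_dtens act_pt mulVg invgK.
Qed.

Lemma top_ind_bij : bijective top_ind.
Proof.
apply: inj_surj_bij => [|y]; last first.
  by have [x <-] := h0_surj y; exists (collapse x); apply: top_ind_collapse.
apply: linear_inj_of_ker => x x0.
have cK : collapse (dtmap idfun (pt M 1%g) x) = x.
  suff DE : collapse \o dtmap idfun (pt M 1%g) =1 idfun by exact: DE.
  apply: tensor_linear_ext => c m.
  rewrite -[LHS]/(collapse (dtmap idfun (pt M 1%g) (tens c m))) dtmap_tens collapse_pt.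
  by rewrite ract1.
rewrite -cK; apply: h0_invariant x0; exact: collapse_act.
Qed.
End Object.

Lemma top_ind_natural (M N : lmodType R) (g : {linear M -> N}) x :
  hhom (diag_map C (ind_map G g)) 0 (top_ind M x) = top_ind N (tensor_map idfun g x).
Proof.
suff DE : hhom (diag_map C (ind_map G g)) 0 \o top_ind M =1 top_ind N \o tensor_map idfun g.
  exact: DE.
apply: tensor_linear_ext => c m.
rewrite -[LHS]/(hhom (diag_map C (ind_map G g)) 0 (top_ind M (tens c m))).
rewrite -[RHS]/(top_ind N (tensor_map idfun g (tens c m))) tensor_map_tens !top_ind_tens.
by rewrite h0_natural diag_map_dtens ind_map_pt.
Qed.

End TopInduced.

Section DualityConsequences.
Variables (R : comPzRingType) (G : groupType) (C : rgmodule R G) (n : nat).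
Hypothesis duality : natural_duality C n.

Let iso (k : int) : nat_iso C k (n%:Z - k) := duality k.

Lemma duality_above k (A : gmodule R G) : (n < k)%N -> coh_vanishes A k.
Proof.
move=> nk; apply/coh_vanishesP => x; have := iso k.
have -> : n%:Z - k%:Z = Negz (k - n).-1 by lia.
move=> [phi [phiB _]]; apply: (bij_inj (phiB A)).
by rewrite [LHS]thinmx0 [RHS]thinmx0.
Qed.

(** The dual degree n - k is positive, where [diag C (ind G M)] has no homology. *)
Lemma duality_below k (M : lmodType R) : (k < n)%N -> coh_vanishes (ind G M) k.
Proof.
move=> kn; apply/coh_vanishesP => x; have := iso k.
have -> : n%:Z - k%:Z = (n - k).-1.+1 by lia.
move=> [phi [phiB _]]; apply: (bij_inj (phiB (ind G M))).
have /hom_vanishesP H0 := @diag_ind_hom_vanishes R G C M (n - k).-1.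
by rewrite [LHS]H0 [RHS]H0.
Qed.

Lemma duality_top : exists theta : forall M : lmodType R, {linear tensor C M -> Hcoh (ind G M) n},
  (forall M, bijective (theta M)) /\
  (forall (M N : lmodType R) (g : {linear M -> N}) x,
     hcoh (ind_map G g) n (theta M x) = theta N (tensor_map idfun g x)).
Proof.
have := iso n; have -> : n%:Z - n%:Z = 0%N by lia.
move=> [phi [phiB phiN]].
have inv (A : gmodule R G) := linear_inv (phiB A).
pose psi A := sval (cid (inv A)).
have psiK A : cancel (psi A) (phi A) by case: (svalP (cid (inv A))).
have phiK A : cancel (phi A) (psi A) by case: (svalP (cid (inv A))).
exists (fun M => psi (ind G M) \o top_ind C M); split=> [M|M N g x].
  apply: bij_comp; last exact: top_ind_bij.
  by exists (phi (ind G M)); [apply: psiK|apply: phiK].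
apply: (can_inj (phiK (ind G N))).
rewrite -[LHS]/(phi (ind G N) (Hcoh_map (ind_map G g) (psi (ind G M) (top_ind C M x)))).
rewrite -[RHS]/(phi (ind G N) (psi (ind G N) (top_ind C N (tensor_map idfun g x)))).
rewrite phiN (psiK (ind G M)) (psiK (ind G N)).
exact: top_ind_natural.
Qed.

End DualityConsequences.

Section DualCriterion.
Variables (R : comPzRingType) (G : groupType) (n : nat) (C : lmodType R).
Variable theta : forall M : lmodType R, {linear tensor C M -> Hcoh (ind G M) n}.
Hypothesis theta_bij : forall M, bijective (theta M).
Hypothesis theta_natural : forall (M N : lmodType R) (g : {linear M -> N}) x,
  hcoh (ind_map G g) n (theta M x) = theta N (tensor_map idfun g x).

Lemma tens_one_bij : bijective (tens_l C (1 : R^o)).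
Proof.
have bl (r : R^o) : linear (fun c : C => r *: c).
  by move=> a c c'; rewrite scalerDr !scalerA mulrC.
have br (c : C) : linear (fun r : R^o => r *: c) by exact: scal_linear.
exists (tensor_lift bl br) => x; first by rewrite [LHS]tensor_lift_tens scale1r.
pose D : {linear tensor C R^o -> tensor C R^o} := tens_l C (1 : R^o) \o tensor_lift bl br.
suff DE : D =1 idfun by exact: (DE x).
apply: tensor_ext => c r.
rewrite -[LHS]/(tens_l C (1 : R^o) (tensor_lift bl br (tens c r))) tensor_lift_tens.
by rewrite linearZ_LR -[RHS]/(tens c r) -[in RHS](mulr1 r) -tensZr.
Qed.

Definition dual_iso : {linear C -> dual R G n} := theta R^o \o tens_l C (1 : R^o).

Lemma dual_iso_bij : bijective dual_iso.
Proof. exact: (bij_comp (theta_bij R^o) tens_one_bij). Qed.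

(** Naturality along the map R -> M with 1 |-> m determines [theta M] on c (x) m from [theta R^o] on
    c (x) 1. *)
Lemma theta_mu (M : lmodType R) x : theta M x = dual_mu G n M (tensor_map dual_iso idfun x).
Proof.
suff DE : theta M =1 dual_mu G n M \o tensor_map dual_iso idfun by exact: DE.
apply: tensor_ext => c m.
rewrite -[RHS]/(dual_mu G n M (tensor_map dual_iso idfun (tens c m))) tensor_map_tens dual_mu_tens.
rewrite -[RHS]/(hcoh _ n (theta R^o (tens c (1 : R^o)))) theta_natural.
by rewrite tensor_map_tens scalE scale1r.
Qed.

Lemma dual_mu_bij (M : lmodType R) : bijective (dual_mu G n M).
Proof.
have [e' [eK eK']] := linear_inv dual_iso_bij.
have tK : cancel (tensor_map e' (@idfun M)) (tensor_map dual_iso (@idfun M)).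
  move=> x.
  suff DE : tensor_map dual_iso (@idfun M) \o tensor_map e' (@idfun M) =1 idfun by exact: DE.
  apply: tensor_ext => d m.
  rewrite -[LHS]/(tensor_map dual_iso idfun (tensor_map e' idfun (tens d m))) !tensor_map_tens.
  by congr tens; apply: eK'.
have tK' : cancel (tensor_map dual_iso (@idfun M)) (tensor_map e' (@idfun M)).
  move=> x.
  suff DE : tensor_map e' (@idfun M) \o tensor_map dual_iso (@idfun M) =1 idfun by exact: DE.
  apply: tensor_ext => d m.
  rewrite -[LHS]/(tensor_map e' idfun (tensor_map dual_iso idfun (tens d m))) !tensor_map_tens.
  by congr tens; apply: eK.
apply: (@eq_bij _ _ (theta M \o tensor_map e' (@idfun M))).
  exact: (bij_comp (theta_bij M) (Bijective tK tK')).
by move=> x; rewrite -[LHS]/(theta M (tensor_map e' idfun x)) theta_mu tK.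
Qed.

End DualCriterion.

Section Transfer.
Variables (R : comPzRingType) (G H : groupType) (phi : G -> H) (psi : H -> G).
Hypotheses (phiC : coarse_map phi) (psiC : coarse_map psi).
Hypotheses (psiphi : close (psi \o phi) id) (phipsi : close (phi \o psi) id).

Lemma ind_coh_vanishes_transfer (M : lmodType R) k :
  coh_vanishes (ind G M) k -> coh_vanishes (ind H M) k.
Proof.
move=> /coh_vanishesP G0; apply/coh_vanishesP => x.
apply: (bij_inj (pull_ind_bij phiC psiC M k phipsi psiphi)).
by rewrite [LHS]G0 [RHS]G0.
Qed.

(** Following [theta] by the pullback keeps it bijective and natural in [M], so [dual_mu] is
    bijective for [H]. The isomorphism from C to [dual R H n] is R-linear, which is what the
    Poincaré condition asks for. *)
Lemma duality_transfer (C : rgmodule R G) n : natural_duality C n ->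
  (forall k (A : gmodule R H), (n < k)%N -> coh_vanishes A k) ->
  natural_duality (dual R H n) n /\ exists e : {linear C -> dual R H n}, bijective e.
Proof.
move=> dC above; have [theta [thetaB thetaN]] := duality_top dC.
pose theta' M : {linear tensor C M -> Hcoh (ind H M) n} := pull_ind psiC M n \o theta M.
have theta'B M : bijective (theta' M).
  exact: (bij_comp (pull_ind_bij psiC phiC M n psiphi phipsi) (thetaB M)).
have theta'N (M N : lmodType R) (g : {linear M -> N}) x :
    hcoh (ind_map H g) n (theta' M x) = theta' N (tensor_map idfun g x).
  by rewrite -[RHS]/(pull_ind psiC N n (theta N _)) -thetaN -pull_ind_natural.
split; last by exists (dual_iso theta'); apply: dual_iso_bij.
apply: dual_natural_duality => //; last exact: dual_mu_bij theta'B theta'N.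
by move=> k M kn; apply/ind_coh_vanishes_transfer/(duality_below dC).
Qed.

End Transfer.

(** * Vanishing above the top degree in finite cohomological dimension *)

Section FiniteDimension.
Variables (R : comPzRingType) (H : groupType).

Lemma cd_finite : (cd R H < +oo)%E ->
  exists N, forall k (A : gmodule R H), (N < k)%N -> coh_vanishes A k.
Proof.
rewrite /cd; set S := (X in ereal_sup X) => Slt.
have [N NS] : exists N : nat, forall k, S (k%:R)%:E -> (k <= N)%N.
  have Sub x : S x -> (x <= ereal_sup S)%E by apply: ereal_sup_ubound.
  case: (ereal_sup S) Slt Sub => [r| |] // _ Sub.
  - exists (Num.trunc r).+1 => k /Sub; rewrite lee_fin => kr.
    rewrite -(ler_nat Rdefinitions.R); apply: (le_trans kr).
    exact/ltW/truncnS_gt.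
  (* A supremum of -oo means that no degree occurs, and any bound will do. *)
  - by exists 0%N => k /Sub; rewrite leeNy_eq.
exists N => k A Nk; apply/coh_vanishesP => x; apply: contrapT => x0.
have /NS : S (k%:R)%:E by exists k => //; exists A, x; apply/eqP.
by rewrite leqNgt Nk.
Qed.

Lemma coh_vanishes_above n N :
  (forall k (M : lmodType R), (n < k)%N -> coh_vanishes (ind H M) k) ->
  (forall k (A : gmodule R H), (N < k)%N -> coh_vanishes A k) ->
  forall k (A : gmodule R H), (n < k)%N -> coh_vanishes A k.
Proof.
move=> ind0 top k; move: (leqnn (N.+1 - k)).
(* Induction on a bound [d] for the distance from [k] up to [N.+1]; at 0 the bound [N] applies. *)
move: {2}(N.+1 - k)%N => d; elim: d k => [|d IH] k kd A nk.
  by apply: top; lia.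
apply/coh_vanishesP => x.
have [|y <-] := @hses_surj _ _ _ _ _ (ind_ses A) k _ x.
  by apply: IH; lia.
have /coh_vanishesP F0 := ind0 k A nk.
by rewrite (F0 y) raddf0.
Qed.

End FiniteDimension.

(** * Amenable groups *)

Section PulledModule.
Variables (R : comPzRingType) (W : lmodType R).

Lemma pulled_trans (F G H : groupType) (theta : F -> G) (phi : G -> H) (L : set (H -> W)) :
  pulled theta (pulled phi L) `<=` pulled (phi \o theta) L.
Proof.
move=> f [E [Ef EL] fE].
have ex e : exists D : set (H -> W), E e ->
    [/\ finite_set D, D `<=` L & forall x, exists2 d, D d & e x = d (phi x)].
  have [Ee|nEe] := pselect (E e); last by exists set0.
  by have [D [Df DL] De] := EL e Ee; exists D.
pose D e := sval (cid (ex e)).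
have DP e : E e -> [/\ finite_set (D e), D e `<=` L & forall x, exists2 d, D e d & e x = d (phi x)].
  exact: (svalP (cid (ex e))).
exists (\bigcup_(e in E) D e).
  split; first by apply: bigcup_finite => // e /DP[].
  by move=> d [e /DP[_ DL _] /DL].
move=> x; have [e Ee ->] := fE x; have [_ _ /(_ (theta x))[d Dd ->]] := DP e Ee.
by exists d => //; exists e.
Qed.

Variables (G H : groupType) (phi : G -> H) (L : localmod W H).

(** [phi' x] is a left translate of [phi x] by one of finitely many elements, and [L] is stable
    under left translation. *)
Lemma pulled_close (phi' : G -> H) :
  finite_set [set (phi' x * (phi x)^-1)%g | x in [set: G]] -> pulled phi' L `<=` pulled phi L.
Proof.
set C := [set _ | _ in _] => Cf f [E [Ef EL] fE].
exists [set (fun y => p.1 (p.2 * y)%g) | p in E `*` C].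
  split; first exact/finite_image/finite_setX.
  by move=> _ [[e c] [/= Ee _] <-]; apply/local_shift/EL.
move=> x; have [e Ee ->] := fE x.
exists (fun y => e (phi' x * (phi x)^-1 * y)%g); last by rewrite mulgVK.
by exists (e, (phi' x * (phi x)^-1)%g) => //; split=> //; exists x.
Qed.

Fact pulled0 : pulled phi L 0.
Proof.
exists [set 0]; last by move=> x; exists 0.
by split; [exact: finite_set1|move=> _ ->; apply: insubm0].
Qed.
Fact pulledP (a : R) (f g : G -> W) :
  pulled phi L f -> pulled phi L g -> pulled phi L (a *: f + g).
Proof.
move=> [E [Ef EL] fE] [E' [Ef' EL'] gE].
exists [set a *: p.1 + p.2 | p in E `*` E'].
  split; first exact/finite_image/finite_setX.
  by move=> _ [[e e'] [/= Ee Ee'] <-]; apply: insubmP; [apply: EL|apply: EL'].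
move=> x; have [e Ee fe] := fE x; have [e' Ee' ge] := gE x.
exists (a *: e + e'); first by exists (e, e').
by rewrite -[LHS]/(a *: f x + g x) fe ge.
Qed.
(** The coefficient module that G receives from [L]: [phi] pulls [L] into it by construction, and a
    coarse inverse pulls it back into [L] because [L] is local. *)
Definition pulled_submodule : submodule (G -> W) := @Submodule R (G -> W) _ pulled0 pulledP.

Hypothesis phiC : controlled phi.

Fact pulled_local : local pulled_submodule.
Proof.
move=> theta thC f /pulled_trans; apply: pulled_close.
apply: sub_finite_set (controlledP phiC thC).
by move=> _ [x _ <-]; exists (theta x, x) => //; exists x.
Qed.
Definition pulled_loc : localmod W G := LocalMod pulled_local.

Lemma coh_vanishes_fmod (psi : H -> G) k :
  controlled psi -> close (phi \o psi) id ->
  (forall B : gmodule R G, coh_vanishes B k) -> coh_vanishes (fmod L) k.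
Proof.
move=> psiC phipsi B0; apply/coh_vanishesP => x.
have phiL : pulled phi L `<=` pulled_loc by [].
have psiL : pulled psi pulled_loc `<=` L.
  by move=> f /pulled_trans; apply: llocal.
apply: (can_inj (pull_cohK phiC psiC phipsi phiL psiL (n := k))).
have /coh_vanishesP H0 := B0 (fmod pulled_loc).
by rewrite [LHS]H0 [RHS]H0.
Qed.

End PulledModule.

(** * From a real mean to a measure and an integral over R *)

Section RationalFunctional.

Definition avoids_one (S : set reals) : Prop :=
  [/\ forall x y, S x -> S y -> S (x + y), forall q x, S x -> S (ratr q * x) & ~ S 1].

(* [K] is a complement of [rat] in [reals] as a rational vector space: a maximal
   subspace that avoids 1. *)
Lemma ratio_complement : exists K : set reals,
  [/\ K 0, avoids_one K & forall x, exists q : rat, K (x - ratr q)].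
Proof.
have [F FP Ft|A [AP Amax]] := @Zorn_bigcup reals avoids_one.
  split.
  - move=> x y [S FS Sx] [S' FS' Sy].
    have [SS'|S'S] := Ft S S' FS FS'.
      by exists S' => //; have [D _ _] := FP S' FS'; apply: D => //; apply: SS'.
    by exists S => //; have [D _ _] := FP S FS; apply: D => //; apply: S'S.
  - by move=> q x [S FS Sx]; exists S => //; have [_ Z _] := FP S FS; apply: Z.
  - by move=> [S /FP[_ _ S1]].
have [AD AZ A1] := AP.
(* The empty set satisfies [avoids_one], as Zorn's lemma demands for the empty chain, so 0 is added
   by hand. *)
pose K := A `|` [set 0].
have KD x y : K x -> K y -> K (x + y).
  move=> [Ax|->] [Ay|->]; rewrite ?addr0 ?add0r; [left; exact: AD|by left|by left|by right].
have KZ q x : K x -> K (ratr q * x).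
  by move=> [Ax|->]; [left; exact: AZ|right; rewrite /= mulr0].
have K1 : ~ K 1 by move=> [//|/eqP]; rewrite oner_eq0.
exists K; split=> //; first by right.
move=> x; apply: contrapT => xK.
(* If no rational works, K + Q x strictly enlarges [A], since x in [A] would allow q = 0. It still
   avoids 1: from 1 = s + q x with q nonzero, x - q^-1 would be a rational multiple of s. *)
pose S := [set y | exists s q, K s /\ y = s + ratr q * x].
apply: (Amax S); last first.
  split.
  - move=> _ _ [s [q [Ks ->]]] [s' [q' [Ks' ->]]]; exists (s + s'), (q + q').
    by split; [exact: KD|rewrite rmorphD mulrDl addrACA].
  - move=> p _ [s [q [Ks ->]]]; exists (ratr p * s), (p * q).
    by split; [exact: KZ|rewrite mulrDr rmorphM mulrA].
  - move=> [s [q [Ks /esym sq]]]; have [q0|q0] := eqVneq q 0.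
      by apply: K1; rewrite -sq q0 rmorph0 mul0r addr0.
    apply: xK; exists q^-1.
    have qx : x = ratr q^-1 * (ratr q * x).
      by rewrite mulrA -rmorphM mulVf // rmorph1 mul1r.
    have -> : x - ratr q^-1 = ratr (- q^-1) * s.
      have -> : s = 1 - ratr q * x by rewrite -sq addrK.
      by rewrite mulrBr mulr1 rmorphN mulNr -qx opprK addrC.
    exact: KZ.
split=> [y Ay|SA]; first by exists y, 0; split; [left|rewrite rmorph0 mul0r addr0].
apply: xK; exists 0; rewrite rmorph0 subr0; left; apply: SA.
by exists 0, 1; split; [right|rewrite rmorph1 mul1r add0r].
Qed.

(** [chi x] is the rational component of [x] along K; it is unique because a nonzero rational in [K]
    would put 1 in [K]. *)
Lemma rational_functional : exists chi : reals -> rat,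
  (forall x y, chi (x + y) = chi x + chi y) /\ chi 1 = 1.
Proof.
have [K [K0 [KD KZ K1] KQ]] := ratio_complement.
have uniq x q q' : K (x - ratr q) -> K (x - ratr q') -> q = q'.
  move=> Kq Kq'; apply: contrapT => qq'; apply: K1.
  have d0 : q - q' != 0 by rewrite subr_eq0; apply/eqP.
  have E : (x - ratr q') + ratr (-1) * (x - ratr q) = ratr (q - q') :> reals.
    by rewrite rmorphN1 mulN1r opprB rmorphB /= addrC addrA subrK.
  have := KZ (q - q')^-1 _ (KD _ _ Kq' (KZ (-1) _ Kq)).
  by rewrite E -rmorphM mulVf // rmorph1.
pose chi x := sval (cid (KQ x)).
have chiP x : K (x - ratr (chi x)) by apply: (svalP (cid (KQ x))).
exists chi; split=> [x y|].
  apply: (uniq (x + y)) => //; rewrite rmorphD opprD addrACA; exact: KD.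
by apply: (uniq 1) => //; rewrite rmorph1 subrr.
Qed.

End RationalFunctional.

Section FiniteMean.
Variables (R : comPzRingType) (H : groupType).

(** What survives of a mean, on indicator functions, when its values are moved from the reals to R:
    total mass, finite additivity and invariance. *)
Record fmean := FMean {
  fm :> set H -> R;
  fmT : fm setT = 1;
  fmU : forall S S', S `&` S' = set0 -> fm (S `|` S') = fm S + fm S';
  fm_shift : forall s S, fm [set x | S (s * x)%g] = fm S
}.

Lemma amenable_fmean : amenable H -> {rmorphism rat -> R} -> inhabited fmean.
Proof.
move=> [m [mlin _ m1 minv]] iota; have [chi [chiD chi1]] := rational_functional.
pose ind1 (S : set H) (x : H) : reals := if `[< S x >] then 1 else 0.
have ind1_bd S : bounded_real (ind1 S).
  by exists 1 => x; rewrite /ind1; case: ifP; rewrite ?normr1 ?normr0.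
split; exists (fun S => iota (chi (m (ind1 S)))).
- rewrite (_ : ind1 setT = fun=> 1) ?m1 ?chi1 ?rmorph1 //.
  by apply/funext => x; rewrite /ind1 asboolT.
- move=> S S' SS'; rewrite -rmorphD -chiD; congr (iota (chi _)).
  rewrite -[m (ind1 S)]mul1r -mlin //; congr m; apply/funext => x; rewrite mul1r /ind1.
  have [Sx|nSx] := pselect (S x).
    have nS'x : ~ S' x by move=> S'x; rewrite -[False]/(set0 x) -SS'.
    by rewrite (asboolT (or_introl Sx : (S `|` S') x)) (asboolT Sx) (asboolF nS'x) addr0.
  have [S'x|nS'x] := pselect (S' x).
    by rewrite (asboolT (or_intror S'x : (S `|` S') x)) (asboolT S'x) (asboolF nSx) add0r.
  have nSS'x : ~ (S `|` S') x by case.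
  by rewrite (asboolF nSS'x) (asboolF nSx) (asboolF nS'x) addr0.
- move=> s S; congr (iota (chi _)); exact: (minv s (ind1 S)).
Qed.

Variable q : fmean.

Lemma fm0 : q set0 = 0.
Proof.
have := fmU q (set0I set0); rewrite set0U => /eqP.
by rewrite -subr_eq subrr eq_sym => /eqP.
Qed.

Lemma fm_sum (T : eqType) (P : H -> T) (p : pred T) (s : seq T) : uniq s ->
  q [set x | P x \in s /\ p (P x)] = \sum_(t <- s | p t) q [set x | P x = t].
Proof.
elim: s => [_|t s IH /= /andP[ts us]].
  rewrite big_nil -fm0; congr (fm q); apply/seteqP; split=> x //= [].
  by rewrite in_nil.
rewrite big_cons -IH //; case: ifP => pt.
  rewrite -fmU.
    congr (fm q); apply/seteqP; split=> x /=.
      by rewrite inE => -[/orP[/eqP|] ? ?]; [left|right].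
    by move=> [->|[xs px]]; rewrite inE ?eqxx // xs orbT.
  apply/seteqP; split=> x //= [Pxt [xs _]].
  by move: ts; rewrite -Pxt xs.
congr (fm q); apply/seteqP; split=> x /=.
  by rewrite inE => -[/orP[/eqP ->|] //]; rewrite pt.
by move=> [xs px]; rewrite inE xs orbT.
Qed.

Variable A : lmodType R.

Definition integral (f : H -> A) : A := \sum_(a \in range f) q [set x | f x = a] *: a.

(** The integral can be computed on any finite partition finer than the level sets of [f], because
    pieces with the same value add up by [fm_sum]. *)
Lemma integralE (T : eqType) (P : H -> T) (v : T -> A) (s : seq T) (f : H -> A) :
  uniq s -> (forall x, P x \in s) -> (forall x, f x = v (P x)) ->
  integral f = \sum_(t <- s) q [set x | P x = t] *: v t.
Proof.
move=> us Ps fv; pose r := undup (map v s).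
have fr x : f x \in r by rewrite mem_undup fv; apply/mapP; exists (P x).
rewrite /integral (@fsbig_widen _ _ _ _ _ [set` r]); first last.
- move=> a [_ /= na]; rewrite (_ : [set x | _] = set0) ?fm0 ?scale0r //.
  by apply/seteqP; split=> x //= fxa; apply: na; exists x.
- by move=> _ [x _ <-] /=.
rewrite -fsbig_seq ?undup_uniq //.
have E a : q [set x | f x = a] = \sum_(t <- s | v t == a) q [set x | P x = t].
  rewrite -fm_sum //; congr (fm q); apply/seteqP; split=> x /=.
    by rewrite fv => ->.
  by rewrite fv => -[_ /eqP].
under eq_bigr do rewrite E scaler_suml big_mkcond.
rewrite exchange_big /=; apply: eq_big_seq => t ts.
rewrite -big_mkcond (eq_bigl (pred1 (v t))) => [|a]; last by rewrite /= eq_sym.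
rewrite -big_filter filter_pred1_uniq ?undup_uniq ?big_seq1 //.
by rewrite mem_undup map_f.
Qed.

Lemma finite_cover (T : choiceType) (P : H -> T) : finite_set (range P) ->
  exists2 s : seq T, uniq s & forall x, P x \in s.
Proof.
move=> /finite_seqP[s Ps]; exists (undup s); rewrite ?undup_uniq // => x.
have : [set` s] (P x) by rewrite -Ps; exists x.
by rewrite mem_undup.
Qed.

Lemma integral_linear a f g : finite_set (range f) -> finite_set (range g) ->
  integral (fun x => a *: f x + g x) = a *: integral f + integral g.
Proof.
move=> /finite_cover[s us fs] /finite_cover[s' us' gs'].
(* The level sets of the pair refine those of [f], of [g] and of the combination. *)
pose P x := (f x, g x); pose r := [seq (x, y) | x <- s, y <- s'].
have ur : uniq r by apply: allpairs_uniq => // -[x y] [x' y'] _ _ /= [-> ->].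
have Pr x : P x \in r by apply/allpairsP; exists (P x); split; [apply: fs|apply: gs'|].
rewrite (integralE (v := fun t => a *: t.1 + t.2) ur Pr) //.
rewrite (integralE (v := fst) (f := f) ur Pr) // (integralE (v := snd) (f := g) ur Pr) //.
rewrite scaler_sumr -big_split /=; apply: eq_bigr => t _.
by rewrite scalerDr !scalerA mulrC.
Qed.

Lemma integral_map (h : {linear A -> A}) f : finite_set (range f) ->
  integral (fun x => h (f x)) = h (integral f).
Proof.
move=> /finite_cover[s us fs].
rewrite (integralE (v := h) us fs) // (integralE (v := id) (f := f) us fs) // linear_sum.
by apply: eq_bigr => t _; rewrite linearZ_LR.
Qed.

Lemma integral_shift f g : finite_set (range f) ->
  integral (fun x => f (g * x)%g) = integral f.
Proof.
move=> /finite_cover[s us fs].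
rewrite (integralE (P := fun x => f (g * x)%g) (v := id) us) //.
rewrite (integralE (v := id) (f := f) us fs) //; apply: eq_bigr => t _.
by congr (_ *: _); apply: (fm_shift q g [set x | f x = t]).
Qed.

Lemma integral_cst a : integral (fun=> a) = a.
Proof.
rewrite (integralE (P := fun=> a) (v := id) (s := [:: a])) // => [|x]; last exact: mem_head.
rewrite big_seq1 (_ : [set x | _] = setT) ?fmT ?scale1r //.
by apply/seteqP; split.
Qed.

End FiniteMean.

Section FiniteOrbitFunctions.
Variables (R : comPzRingType) (H : groupType) (A : gmodule R H).

(* The functions [f : H -> A] such that [y f(y)] takes finitely many values form a local
   module, of which [A] is a direct summand when [H] is amenable. *)
Definition untwisted (f : H -> A) : H -> A := fun y => gact A y (f y).
Definition fin_range (f : H -> A) : Prop := finite_set (range (untwisted f)).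

Fact fin_range0 : fin_range 0.
Proof.
apply: (@sub_finite_set _ _ [set 0]); last exact: finite_set1.
by move=> _ [y _ <-]; rewrite /untwisted raddf0.
Qed.
Fact fin_rangeP a f g : fin_range f -> fin_range g -> fin_range (a *: f + g).
Proof.
move=> ff fg; apply: sub_finite_set (finite_image (fun p => a *: p.1 + p.2) (finite_setX ff fg)).
move=> _ [y _ <-]; exists (untwisted f y, untwisted g y); first by split; exists y.
by rewrite /= /untwisted -linearP.
Qed.
Definition fin_range_submodule : submodule (H -> A) :=
  @Submodule R (H -> A) fin_range fin_range0 fin_rangeP.

(** y e(theta y) is (theta y y^-1)^-1 applied to theta y e(theta y); both the group element and the
    vector range over finite sets. *)
Fact fin_range_local : local fin_range_submodule.
Proof.
move=> theta thC f [E [Ef EL] fE].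
pose C := [set (theta x * (id x)^-1)%g | x in [set: H]].
have Cf : finite_set C := thC.
apply: (@sub_finite_set _ _
  [set gact A p.1^-1%g p.2 | p in C `*` (\bigcup_(e in E) range (untwisted e))]).
  move=> _ [y _ <-]; have [e Ee fe] := fE y.
  exists ((theta y * (id y)^-1)%g, untwisted e (theta y)).
    by split; [exists y|exists e => //; exists (theta y)].
  by rewrite /= /untwisted -gactM fe invgM invgK mulgVK.
by apply/finite_image/finite_setX => //; apply: bigcup_finite => // e /EL.
Qed.
Definition fin_range_loc : localmod A H := LocalMod fin_range_local.

Fact cst_fin_range a : fin_range (fun y => gact A y^-1%g a).
Proof.
apply: (@sub_finite_set _ _ [set a]); last exact: finite_set1.
by move=> _ [y _ <-] /=; rewrite /untwisted -gactM mulgV gact1.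
Qed.
Definition cst_fun (a : A) : fmod fin_range_loc :=
  @insubm_sub R (H -> A) fin_range_loc _ (cst_fin_range a).
Fact cst_linear : linear cst_fun.
Proof. by move=> r a b; apply: val_inj; apply/funext => y; apply: (linearP (gact A y^-1%g)). Qed.
Fact cst_act g a : mk_linear cst_linear (gact A g a) =
  gact (fmod fin_range_loc) g (mk_linear cst_linear a).
Proof. by apply: val_inj; apply/funext => y /=; rewrite -gactM invgM invgK. Qed.
Definition cst_hom : ghom A (fmod fin_range_loc) := GHom cst_act.

Variable q : fmean R H.

Definition mean_fun (f : fmod fin_range_loc) : A := integral q (untwisted (val f)).
Fact mean_linear : linear mean_fun.
Proof.
move=> a f g; rewrite /mean_fun -integral_linear.
- by congr integral; apply/funext => y; rewrite -linearP.
- exact: (subm_prop f).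
- exact: (subm_prop g).
Qed.
(** y f(g^-1 y) is g applied to the untwisted f at g^-1 y; linearity moves g out of the integral,
    and invariance of the measure absorbs the shift. *)
Fact mean_act g f : mk_linear mean_linear (gact (fmod fin_range_loc) g f) =
  gact A g (mk_linear mean_linear f).
Proof.
have ff : finite_set (range (untwisted (val f))) := subm_prop f.
rewrite /= /mean_fun -integral_map // -[RHS](integral_shift q g^-1%g).
  congr integral; apply/funext => y; rewrite /untwisted fmod_act.
  by rewrite -gactM mulVKg.
apply: sub_finite_set (finite_image (gact A g) ff) => _ [y _ <-].
by exists (untwisted (val f) y) => //; exists y.
Qed.
Definition mean_hom : ghom (fmod fin_range_loc) A := GHom mean_act.

Lemma mean_cst a : mean_hom (cst_hom a) = a.
Proof.
rewrite -[RHS](integral_cst q); congr integral; apply/funext => y.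
by rewrite /untwisted /= -gactM mulgV gact1.
Qed.

End FiniteOrbitFunctions.

Lemma amenable_coh_vanishes (R : comPzRingType) (G H : groupType) (phi : G -> H) (psi : H -> G) k :
  controlled phi -> controlled psi -> close (phi \o psi) id ->
  amenable H -> {rmorphism rat -> R} ->
  (forall B : gmodule R G, coh_vanishes B k) -> forall A : gmodule R H, coh_vanishes A k.
Proof.
move=> phiC psiC phipsi Ham iota G0 A.
have [q] := amenable_fmean Ham iota.
apply: coh_vanishes_retract (mean_cst q) _.
exact: (coh_vanishes_fmod phiC psiC phipsi G0).
Qed.

(** The second hypothesis, the transfer of vanishing above n, isolates the only point at which the
    two halves of the theorem differ. *)
Lemma coarse_duality (R : comPzRingType) (G H : groupType) :
  coarsely_equivalent G H ->
  (forall n, (forall k (B : gmodule R G), (n < k)%N -> coh_vanishes B k) ->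
     forall k (A : gmodule R H), (n < k)%N -> coh_vanishes A k) ->
  (duality_group R G -> duality_group R H) /\
  (Poincare_duality_group R G -> Poincare_duality_group R H).
Proof.
move=> [phi [psi [phiC psiC psiphi phipsi]]] above.
have transfer C n (dC : @natural_duality R G C n) :=
  duality_transfer phiC psiC psiphi phipsi dC
    (above n (fun k A nk => duality_above dC (A := A) nk)).
split=> [[C [n dC]]|[C [n [dC [e eB]]]]].
  by exists (dual R H n), n; have [] := transfer C n dC.
have [dD [f /linear_inv[g [fK gK]]]] := transfer C n dC.
exists (dual R H n), n; split=> //; exists (e \o g).
by apply: bij_comp => //; exists f.
Qed.

Lemma coarsely_equivalent_sym (G H : groupType) :
  coarsely_equivalent G H -> coarsely_equivalent H G.
Proof. by move=> [phi [psi []]]; exists psi, phi. Qed.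

Lemma above_of_cd (R : comPzRingType) (G H : groupType) : coarsely_equivalent G H ->
  (cd R H < +oo)%E -> forall n,
  (forall k (B : gmodule R G), (n < k)%N -> coh_vanishes B k) ->
  forall k (A : gmodule R H), (n < k)%N -> coh_vanishes A k.
Proof.
move=> [phi [psi [phiC psiC psiphi phipsi]]] /cd_finite[N top] n G0.
apply: coh_vanishes_above top => k M nk.
exact: (ind_coh_vanishes_transfer phiC psiC psiphi phipsi (G0 k (ind G M) nk)).
Qed.

Lemma above_of_amenable (R : comPzRingType) (G H : groupType) : coarsely_equivalent G H ->
  amenable H -> {rmorphism rat -> R} -> forall n,
  (forall k (B : gmodule R G), (n < k)%N -> coh_vanishes B k) ->
  forall k (A : gmodule R H), (n < k)%N -> coh_vanishes A k.
Proof.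
move=> [phi [psi [phiC psiC psiphi phipsi]]] Ham iota n G0 k A nk.
by apply: (amenable_coh_vanishes phiC.2 psiC.2 phipsi Ham iota) => B; apply: G0.
Qed.

Theorem corollary4p48 (R : comPzRingType) :
  (forall G H : groupType,
     countable [set: G] -> countable [set: H] ->
     (cd R G < +oo)%E -> (cd R H < +oo)%E ->
     coarsely_equivalent G H ->
     (duality_group R G <-> duality_group R H) /\
     (Poincare_duality_group R G <-> Poincare_duality_group R H))
  /\
  (forall G H : groupType,
     countable [set: G] -> countable [set: H] ->
     coarsely_equivalent G H ->
     amenable G -> amenable H ->
     (exists f : {rmorphism rat -> R}, injective f) ->
     (duality_group R G <-> duality_group R H) /\
     (Poincare_duality_group R G <-> Poincare_duality_group R H)).
Proof.
split=> [G H _ _ cdG cdH GH|G H _ _ GH Gam Ham [iota _]];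
  have HG := coarsely_equivalent_sym GH.
- have [d p] := coarse_duality GH (above_of_cd GH cdH).
  by have [d' p'] := coarse_duality HG (above_of_cd HG cdG).
- have [d p] := coarse_duality GH (above_of_amenable GH Ham iota).
  by have [d' p'] := coarse_duality HG (above_of_amenable HG Gam iota).
Qed.
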